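(* Let $V$ be the Volterra operator on $L^2[0,1]$, $Vf(t)=\int_0^t f(s)\,ds$. Then $\Lambda(V)=(0,1]$.
   Context: $V$ is quasinilpotent. For quasinilpotent $T$ and $x\neq 0$, $k_x(T)=\limsup_{\lambda\to0}\frac{\ln\|(\lambda-T)^{-1}x\|}{\ln\|(\lambda-T)^{-1}\|}$, and the power set is $\Lambda(T)=\{k_x(T): x\neq0\}$. *)

(* Defs.v *)
From HB Require Import structures.
From mathcomp Require Import all_boot all_order all_algebra.
From mathcomp Require Import all_classical all_reals all_analysis.
Set Implicit Arguments. Unset Strict Implicit. Unset Printing Implicit Defensive.
Import Order.TTheory GRing.Theory Num.Theory.
Import numFieldNormedType.Exports.
Local Open Scope classical_set_scope.
Local Open Scope ring_scope.

(* Complex L^2[0,1] is modelled concretely: a complex-valued function f on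
   [0,1] is a pair (Re f, Im f) of real functions; a complex scalar
   lambda = a + i b is a pair (a, b).  Elements of L^2 are functions with
   square-integrable real and imaginary parts; equality in L^2 is equality
   almost everywhere on [0,1]. *)

Section L2Volterra.
Variable R : realType.

Definition cfun := ((R -> R) * (R -> R))%type.
Definition cscalar := (R * R)%type.

Definition I01 : set R := `[0, 1]%classic.

Definition sq_integrable (u : R -> R) : Prop :=
  measurable_fun I01 u /\
  (\int[@lebesgue_measure R]_(t in I01) ((u t ^+ 2)%:E) < +oo)%E.

Definition L2 (f : cfun) : Prop := sq_integrable f.1 /\ sq_integrable f.2.

Definition L2norm (f : cfun) : R :=
  Num.sqrt (Rintegral (@lebesgue_measure R) I01
              (fun t => f.1 t ^+ 2 + f.2 t ^+ 2)).

Definition cabs (l : cscalar) : R := Num.sqrt (l.1 ^+ 2 + l.2 ^+ 2).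

Definition cscale (l : cscalar) (f : cfun) : cfun :=
  (fun t => l.1 * f.1 t - l.2 * f.2 t, fun t => l.1 * f.2 t + l.2 * f.1 t).
Definition csub (f g : cfun) : cfun :=
  (fun t => f.1 t - g.1 t, fun t => f.2 t - g.2 t).

Definition L2eq (f g : cfun) : Prop :=
  {ae @lebesgue_measure R, forall t, I01 t -> f.1 t = g.1 t /\ f.2 t = g.2 t}.

Definition volterra (f : cfun) : cfun :=
  (fun t => Rintegral (@lebesgue_measure R) `[0, t]%classic f.1,
   fun t => Rintegral (@lebesgue_measure R) `[0, t]%classic f.2).

Definition res_sol (T : cfun -> cfun) (l : cscalar) (x y : cfun) : Prop :=
  L2 y /\ L2eq (csub (cscale l y) (T y)) x.

(* ||(l - T)^{-1} x||  (the solution y is unique in L^2 when l is in the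
   resolvent set, so this sup is the norm of that unique solution) *)
Definition res_vec_norm (T : cfun -> cfun) (l : cscalar) (x : cfun) : R :=
  sup [set L2norm y | y in [set y | res_sol T l x y]].

Definition res_op_norm (T : cfun -> cfun) (l : cscalar) : R :=
  sup [set L2norm y | y in [set y | exists x, L2 x /\ L2norm x <= 1 /\ res_sol T l x y]].

Definition kx (T : cfun -> cfun) (x : cfun) : \bar R :=
  ereal_inf [set ereal_sup
     [set ((ln (res_vec_norm T l x) / ln (res_op_norm T l))%:E)%E
        | l in [set l : cscalar | 0 < cabs l < d]]
   | d in [set d : R | 0 < d]].

Definition power_set (T : cfun -> cfun) : set (\bar R) :=
  [set kx T x | x in [set x | L2 x /\ L2norm x <> 0]].

End L2Volterra.

(* Main.v *)
(* Put z = 1/l. A Gronwall estimate bounds the resolvent by C (1 + |z|)^2 e^|z|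
   and makes it injective; the explicit resolvent z e^(z t) of the constant 1
   bounds its norm from below by e^W e^((Re z)^+) for any given W once l is small.
   In particular the norm tends to infinity, so k_x <= 1.

   For 0 < r <= 1 the resolvent of (t - (1 - r))^+ is e^(z (t - (1 - r))^+) - 1,
   whose norm is at most 2 e^(r (Re z)^+) and grows like e^(r z) for real z, hence
   k_x = r.

   If k_x <= 0, then for real z the Laplace integrals of e^(z (1 - s)) x(s) over
   [0, 1] are O(e^(c z)) for every c > 0. Mikusinski's argument, testing x against
   1 - exp (- e^(z (T - s))), then gives int_0^T x = 0 for all T < 1, and x = 0 by
   Lebesgue differentiation; so k_x > 0 for x <> 0. *)
Require Import Defs.
From HB Require Import structures.
From mathcomp Require Import all_boot all_order all_algebra.
From mathcomp Require Import all_classical all_reals all_analysis measurable_realfun.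
From mathcomp Require Import ring lra.
Set Implicit Arguments. Unset Strict Implicit. Unset Printing Implicit Defensive.
Import Order.TTheory GRing.Theory Num.Theory.
Import numFieldNormedType.Exports.
Local Open Scope classical_set_scope.
Local Open Scope ring_scope.

(** The size of the resolvent depends on the direction in which l tends to 0, and the limsup runs
    over all of them. An upper bound for k_x must therefore compare numerator and denominator
    direction by direction, and both are measured by (Re z)^+; where Re z <= 0 the ramp solutions
    stay bounded, and only the arbitrary W pushes the ratio down. A lower bound for k_x needs one
    direction only: for large z on the positive real axis the logarithm of the operator norm is at
    most (1 + h) z, for any given h > 0, so the polynomial factor of the Gronwall bound disappears.
    The norms are defined by [sup], which is 0 on empty and on unbounded sets; boundedness and
    uniqueness of solutions must be known before these numbers mean anything. Since only exponential
    rates count, crude inequalities such as |a| <= 1 + a^2 suffice to pass between L1 and L2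
    norms. *)

Section Integrals.
Variable R : realType.
Local Notation mu := (@lebesgue_measure R).
Local Notation integ D u := (mu.-integrable D (EFin \o u)).
Implicit Types (u v f F : R -> R) (a b t : R).

(** * Integration on [0,1] and a Fubini form of integration by parts *)

Lemma I01_itv t : I01 t <-> 0 <= t <= 1.
Proof. by rewrite /I01 /= in_itv. Qed.

Lemma mem_itvcc a b t : (t \in `[a, b]%classic) = (a <= t <= b).
Proof.
apply/idP/idP => [h|h]; first by have := set_mem h; rewrite /= in_itv.
by apply/mem_set; rewrite /= in_itv.
Qed.

Lemma measurable_I01 : measurable (@I01 R).
Proof. exact: measurable_itv. Qed.

Lemma mu_itvcc a b : a <= b -> mu `[a, b] = (b - a)%:E.
Proof.
move=> ab; rewrite lebesgue_measure_itv/= lte_fin.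
by case: ltgtP ab => //= -> _; rewrite subrr.
Qed.

Lemma sub_I01 a b : 0 <= a -> b <= 1 -> `[a, b] `<=` (@I01 R).
Proof.
move=> a0 b1 t /=; rewrite in_itv/= => /andP[at_ tb].
by apply/I01_itv; rewrite (le_trans a0)// (le_trans tb).
Qed.

Lemma integ_sub u a b : 0 <= a -> b <= 1 -> integ (@I01 R) u -> integ `[a, b] u.
Proof.
move=> a0 b1; apply: integrableS; [exact: measurable_I01|exact: measurable_itv|].
exact: sub_I01.
Qed.

Lemma integD (D : set R) u v : measurable D ->
  integ D u -> integ D v -> integ D (fun t => u t + v t).
Proof. by move=> mD iu iv; exact: (@integrableD _ _ R mu D mD _ _ iu iv). Qed.

Lemma integB (D : set R) u v : measurable D ->
  integ D u -> integ D v -> integ D (fun t => u t - v t).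
Proof. by move=> mD iu iv; exact: (@integrableB _ _ R mu D mD _ _ iu iv). Qed.

Lemma integZ (D : set R) (c : R) u : measurable D ->
  integ D u -> integ D (fun t => c * u t).
Proof. by move=> mD iu; exact: (@integrableZl _ _ R mu D mD c _ iu). Qed.

Lemma integ_norm (D : set R) u : measurable D ->
  integ D u -> integ D (fun t => `|u t|).
Proof. by move=> mD iu; apply: integrable_norm. Qed.

Lemma integ_le (D : set R) u v : measurable D -> measurable_fun D u ->
  (forall t, D t -> `|u t| <= v t) -> integ D v -> integ D u.
Proof.
move=> mD mu_ uv; apply: le_integrable => //; first exact/measurable_EFinP.
by move=> t Dt /=; rewrite lee_fin (le_trans (uv t Dt))// ler_norm.
Qed.

Lemma integ_meas (D : set R) u : integ D u -> measurable_fun D u.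
Proof. by move/measurable_int/measurable_EFinP. Qed.

Lemma cont_integ u a b : continuous u -> integ `[a, b] u.
Proof.
move=> cu; apply: continuous_compact_integrable; first exact: segment_compact.
exact: continuous_subspaceT.
Qed.

Lemma cont_bound u a b : continuous u -> exists M : R, forall t, a <= t <= b -> `|u t| <= M.
Proof.
move=> cu; have [ab|ba] := leP a b; last first.
  by exists 0 => t /andP[h1 h2]; move: (le_trans h1 h2); rewrite leNgt ba.
have cn : {within `[a, b], continuous (fun t => `|u t|)}.
  apply: continuous_subspaceT => t.
  exact: (continuous_comp (cu t) (@norm_continuous _ R _)).
have [c _ Hc] := EVT_max ab cn.
by exists `|u c| => t tab; apply: Hc; rewrite in_itv.
Qed.

Lemma cont_meas (D : set R) u : continuous u -> measurable_fun D u.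
Proof.
move=> cu; apply: (measurable_funS measurableT) => //.
exact: continuous_measurable_fun.
Qed.

Lemma integ_contM f u : continuous f -> integ (@I01 R) u ->
  integ (@I01 R) (fun t => f t * u t).
Proof.
move=> cf iu; have [M HM] := cont_bound 0 1 cf.
apply: (@integ_le _ _ (fun t => M * `|u t|)) => //.
- exact: measurable_I01.
- by apply: measurable_funM; [exact: cont_meas|exact: integ_meas].
- move=> t /I01_itv It; rewrite normrM ler_wpM2r//; exact: HM.
- apply: integZ; first exact: measurable_I01.
  by apply: integ_norm; first exact: measurable_I01.
Qed.

Lemma is_derive_continuous f F :
  (forall s : R, is_derive s 1 F (f s)) -> continuous F.
Proof.
move=> dF t; apply: differentiable_continuous; apply/derivable1_diffP.
by have [] := dF t.
Qed.

Lemma FTC2 f F a b : a <= b -> continuous f ->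
  (forall t, is_derive t 1 F (f t)) -> Rintegral mu `[a, b] f = F b - F a.
Proof.
rewrite le_eqVlt => /predU1P[->|ab] cf dF.
  by rewrite set_itv1 Rintegral_set1 subrr.
have cF := is_derive_continuous dF.
rewrite /Rintegral (@continuous_FTC2 _ f F) //.
- exact: continuous_subspaceT.
- split.
  + by move=> t _; have [] := dF t.
  + by apply: cvg_at_right_filter; exact: cF.
  + by apply: cvg_at_left_filter; exact: cF.
- by move=> t _; rewrite derive1E derive_val.
Qed.

Lemma EFin_Rintegral (D : set R) u : measurable D -> integ D u ->
  (\int[mu]_(t in D) (u t)%:E)%E = (\int[mu]_(t in D) u t)%:E.
Proof. by move=> mD iu; rewrite /Rintegral fineK//; exact: integrable_fin_num. Qed.

Lemma Rintegral_indicM (D : set R) u :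
  \int[mu]_t (\1_D t * u t) = \int[mu]_(t in D) u t.
Proof.
rewrite [RHS]Rintegral_mkcond; apply: eq_Rintegral => t _.
by rewrite patchE indicE; case: ifPn => _; rewrite ?mul1r ?mul0r.
Qed.

Lemma integ_indicM (D : set R) u : measurable D -> integ setT u ->
  integ setT (fun t => \1_D t * u t).
Proof.
move=> mD iu; apply: (@integ_le _ _ (fun t => `|u t|)) => //.
- by apply: measurable_funM; [exact: measurable_indic|exact: integ_meas].
- move=> t _; rewrite normrM ler_piMl// indicE.
  by case: (_ \in _); rewrite ?normr1 ?normr0.
- exact: integ_norm.
Qed.

(* Fubini on the triangle [0 <= r <= s <= t]; [u] is merely integrable, so [V u]
   need not be differentiable and ordinary integration by parts is not available. *)
Lemma volterra_parts (phi Phi u : R -> R) t : 0 <= t <= 1 ->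
  continuous phi -> (forall s : R, is_derive s 1 Phi (phi s)) ->
  integ (@I01 R) u ->
  \int[mu]_(s in `[0, t]) (phi s * \int[mu]_(r in `[0, s]) u r) =
  \int[mu]_(s in `[0, t]) ((Phi t - Phi s) * u s).
Proof.
move=> /andP[t0 t1] cphi dPhi iu.
set u0 := u \_ (@I01 R).
have iu0 : integ setT u0.
  rewrite /u0 -restrict_EFin.
  by apply/(@integrable_mkcond _ _ R mu _ (EFin \o u) measurable_I01).
have mu0 : measurable_fun setT u0 by exact: integ_meas.
have mge (g : R * R -> R) : measurable_fun setT g -> measurable [set p | 0 <= g p].
  move=> mg; rewrite (_ : [set _ | _] = setT `&` g @^-1` `[0, +oo[).
    by apply: mg => //; exact: measurable_itv.
  by rewrite setTI; apply/seteqP; split=> p /=; rewrite in_itv/= andbT.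
pose A := [set p : R * R | (0 <= p.2) && (p.2 <= p.1) && (p.1 <= t)].
have mA : measurable A.
  rewrite (_ : A = [set p | 0 <= p.2] `&` [set p | 0 <= p.1 - p.2]
                   `&` [set p | 0 <= t - p.1]).
    apply: measurableI; [apply: measurableI|]; apply: mge.
    - exact: measurable_snd.
    - by apply: measurable_funB; [exact: measurable_fst|exact: measurable_snd].
    - by apply: measurable_funB; [exact: measurable_cst|exact: measurable_fst].
  apply/seteqP; split => p; rewrite /A/= !subr_ge0.
    by move=> /andP[/andP[-> ->] ->].
  by move=> [[-> ->] ->].
pose F p := \1_A p * (phi p.1 * u0 p.2).
have mF : measurable_fun setT F.
  apply: measurable_funM; first exact: measurable_indic.
  apply: measurable_funM.
    by apply: measurableT_comp; [exact: cont_meas|exact: measurable_fst].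
  by apply: measurableT_comp; [exact: mu0|exact: measurable_snd].
have memA x y : ((x, y) \in A) = [&& 0 <= y, y <= x & x <= t].
  apply/idP/idP => [h|/and3P[h1 h2 h3]].
    by have /= /andP[/andP[-> ->] ->] := set_mem h.
  by apply/mem_set; rewrite /A/= h1 h2 h3.
(* The same triangle sliced at fixed x, and in [A2] at fixed y, for the two iterated integrals of
   [F]. *)
have A1 x y : \1_A (x, y) = \1_(`[0, t]) x * \1_(`[0, x]) y :> R.
  rewrite !indicE -natrM mulnb memA !mem_itvcc; congr ((nat_of_bool _)%:R).
  apply/idP/idP.
    by move=> /and3P[h1 h2 h3]; rewrite h1 h2 h3 (le_trans h1 h2).
  by move=> /andP[/andP[h1 h2] /andP[h3 h4]]; rewrite h2 h3 h4.
have A2 x y : \1_A (x, y) = \1_(`[0, t]) y * \1_(`[y, t]) x :> R.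
  rewrite !indicE -natrM mulnb memA !mem_itvcc; congr ((nat_of_bool _)%:R).
  apply/idP/idP.
    by move=> /and3P[h1 h2 h3]; rewrite h1 h2 h3 (le_trans h2 h3).
  by move=> /andP[/andP[h1 h2] /andP[h3 h4]]; rewrite h1 h3 h4.
have [M HM] := cont_bound 0 t cphi.
pose N := \int[mu]_y `|u0 y|.
(* As |phi| <= M on [0,t], the inner integral of |F| at x is at most N M for x in [0,t] and 0
   elsewhere, so the iterated integral is finite. *)
have iF : (mu \x mu)%E.-integrable setT (EFin \o F).
  apply/integrable12ltyP; first exact/measurable_EFinP.
  have ic : integ setT (fun x => N * (M * \1_(`[0, t]) x)).
    by apply: integZ => //; apply: integZ => //; exact: integrable_indic_itv.
  apply: le_lt_trans (integrable_lty measurableT ic).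
  apply: ge0_le_integral => //.
  - by move=> x _; apply: integral_ge0.
  - have mFe : measurable_fun setT (fun p => `|(F p)%:E|%E).
      by apply: measurableT_comp => //; exact/measurable_EFinP.
    exact: (@measurable_fun_fubini_tonelli_F _ _ _ _ R mu _ mFe (fun=> abse_ge0 _)).
  - exact: measurable_int ic.
  move=> x _.
  rewrite [leRHS](_ : _ = (\int[mu]_y (M * \1_(`[0, t]) x * `|u0 y|)%:E)%E); last first.
    rewrite EFin_Rintegral//; last by apply: integZ => //; exact: integ_norm.
    by rewrite RintegralZl//=; [rewrite mulrC|exact: integ_norm].
  apply: ge0_le_integral => //.
  - do 2 apply: measurableT_comp => //.
    by apply: measurableT_comp => //; exact: pair1_measurable.
  - do 2 apply: measurableT_comp => //.
    exact: measurableT_comp.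
  move=> y _ /=; rewrite lee_fin /F A1 !normrM/= mulrA ler_wpM2r//.
  rewrite !indicE; case: (boolP (x \in _)); last by rewrite normr0 !mul0r mulr0.
  rewrite mem_itvcc => /HM xM.
  rewrite mulr1 normr1 mul1r; apply: le_trans xM.
  by apply: ler_piMl => //; case: (_ \in _); rewrite ?normr1 ?normr0.
have iphi y : integ setT (fun x => \1_(`[y, t]) x * phi x).
  have := cont_integ y t cphi.
  move/(@integrable_mkcond _ _ R mu _ (EFin \o phi) (measurable_itv _)).
  apply: (@eq_integrable _ _ R mu setT measurableT) => x _.
  by rewrite /= patchE indicE; case: ifPn => _; rewrite ?mul1r ?mul0r.
have := congr1 (@fine R) (Fubini iF).
rewrite (_ : fine _ = \int[mu]_(s in `[0, t]) (phi s * \int[mu]_(r in `[0, s]) u r)).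
  move=> ->; rewrite -Rintegral_indicM; congr fine; apply: eq_integral => y _.
  have Fy x : F (x, y) = \1_(`[0, t]) y * u0 y * (\1_(`[y, t]) x * phi x).
    by rewrite /F A2/=; ring.
  under eq_integral do rewrite /= Fy.
  rewrite EFin_Rintegral//; last first.
    by apply: integZ => //; exact: iphi.
  congr EFin.
  rewrite (RintegralZl _ measurableT (iphi y)).
  rewrite Rintegral_indicM indicE.
  case: (boolP (y \in _)); last by rewrite !mul0r.
  rewrite mem_itvcc => /andP[y0 yt].
  rewrite (FTC2 yt cphi dPhi) /u0 patchE mem_set; last first.
    by apply/I01_itv; rewrite y0 (le_trans yt).
  by ring.
rewrite -[RHS]Rintegral_indicM; congr fine; apply: eq_integral => x _.
have Fx y : F (x, y) = \1_(`[0, t]) x * phi x * (\1_(`[0, x]) y * u0 y).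
  by rewrite /F A1/=; ring.
under eq_integral do rewrite /= Fx.
rewrite EFin_Rintegral//; last by apply: integZ => //; exact: integ_indicM.
rewrite RintegralZl//; last exact: integ_indicM.
rewrite Rintegral_indicM; congr EFin; rewrite -mulrA indicE.
case: (boolP (x \in _)); last by rewrite !mul0r.
rewrite mem_itvcc => /andP[x0 xt]; congr (_ * (_ * _)).
apply: eq_Rintegral => y; rewrite mem_itvcc => /andP[y0 yx].
by rewrite /u0 patchE mem_set//; apply/I01_itv; rewrite y0 (le_trans yx)// (le_trans xt).
Qed.

End Integrals.

(** * Gronwall bound, uniqueness of solutions, and the norms as suprema *)

Section Resolvent.
Variable R : realType.
Local Notation mu := (@lebesgue_measure R).
Local Notation I := (@I01 R).
Local Notation integ D u := (mu.-integrable D (EFin \o u)).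
Local Notation V u t := (Rintegral mu `[0, t]%classic u).
Implicit Types (u v g : R -> R) (t : R) (x y f : cfun R) (l : cscalar R).

Let mI := @measurable_I01 R.

Lemma ae_impl (P Q : R -> Prop) : (forall t, P t -> Q t) ->
  {ae mu, forall t, P t} -> {ae mu, forall t, Q t}.
Proof. exact: (@filterS _ _ (ae_filter_ringOfSetsType mu)). Qed.

Lemma Rintegral_I01_cst (c : R) : \int[mu]_(t in I) c = c.
Proof. by rewrite (@Rintegral_cst _ _ R mu _ mI) [X in fine X]mu_itvcc// subr0 mulr1. Qed.

Lemma integ_I01_cst (c : R) : integ I (fun=> c).
Proof. by apply: cont_integ => t; exact: cst_continuous. Qed.

Lemma sqint_meas u : sq_integrable u -> measurable_fun I u.
Proof. by case. Qed.

Lemma sqint_integ_sq u : sq_integrable u -> integ I (fun t => u t ^+ 2).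
Proof.
move=> [m_u ioo]; apply/integrableP; split.
  by apply/measurable_EFinP; apply: measurable_funX.
by under eq_integral do rewrite /= ger0_norm ?sqr_ge0//.
Qed.

Lemma integ_sq_sqint u : measurable_fun I u -> integ I (fun t => u t ^+ 2) ->
  sq_integrable u.
Proof. by move=> m_u iu; split => //; exact: integrable_lty iu. Qed.

Lemma norm_le_sqr (a : R) : `|a| <= 1 + a ^+ 2.
Proof. by rewrite -real_normK ?num_real//; have := normr_ge0 a; nra. Qed.

Lemma sqint_integ u : sq_integrable u -> integ I u.
Proof.
move=> hu; apply: (@integ_le _ _ _ (fun t => 1 + u t ^+ 2)) => //.
- exact: sqint_meas.
- by move=> t _; exact: norm_le_sqr.
- by apply: integD => //; [exact: integ_I01_cst|exact: sqint_integ_sq].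
Qed.

Lemma sqint_bounded u (M : R) : measurable_fun I u ->
  (forall t, I t -> `|u t| <= M) -> sq_integrable u.
Proof.
move=> m_u uM; apply: integ_sq_sqint => //.
apply: (@integ_le _ _ _ (fun=> M ^+ 2)) => //.
- exact: measurable_funX.
- move=> t It; rewrite normrX; apply: lerXn2r; rewrite ?nnegrE//; last exact: uM.
  by rewrite (le_trans _ (uM t It)).
- exact: integ_I01_cst.
Qed.

Lemma sqint_cont u : continuous u -> sq_integrable u.
Proof.
move=> cu; have [M HM] := cont_bound 0 1 cu.
apply: (@sqint_bounded _ M); first exact: cont_meas.
by move=> t /I01_itv; exact: HM.
Qed.

Lemma sqint_lin (a b : R) u v : sq_integrable u -> sq_integrable v ->
  sq_integrable (fun t => a * u t + b * v t).
Proof.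
move=> hu hv.
have m : measurable_fun I (fun t => a * u t + b * v t).
  by apply: measurable_funD; apply: measurable_funM => //; exact: sqint_meas.
apply: integ_sq_sqint => //.
apply: (@integ_le _ _ _ (fun t => (2 * a ^+ 2) * u t ^+ 2 + (2 * b ^+ 2) * v t ^+ 2)) => //.
- exact: measurable_funX.
- move=> t _; rewrite ger0_norm ?sqr_ge0//.
  by have := sqr_ge0 (a * u t - b * v t); nra.
- by apply: integD => //; apply: integZ => //; exact: sqint_integ_sq.
Qed.

Lemma le_V_I01 u t : 0 <= t <= 1 -> integ I u -> (forall s, I s -> 0 <= u s) ->
  V u t <= \int[mu]_(s in I) u s.
Proof.
move=> /andP[t0 t1] iu u0.
have sI : `[0, t] `<=` I by apply: sub_I01.
rewrite -lee_fin -!EFin_Rintegral//; last exact: integ_sub.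
apply: ge0_subset_integral => //.
exact: measurable_int iu.
Qed.

Lemma V_bound u t : 0 <= t <= 1 -> integ I u ->
  `|V u t| <= \int[mu]_(s in I) `|u s|.
Proof.
move=> /andP[t0 t1] iu; apply: le_trans (le_normr_Rintegral _ _) _ => //.
  exact: integ_sub.
by apply: le_V_I01 => //; [rewrite t0 t1|exact: integ_norm].
Qed.

Lemma V_meas u : integ I u -> measurable_fun I (fun t => V u t).
Proof.
move=> iu; apply: subspace_continuous_measurable_fun => //.
exact: (parameterized_integral_continuous ler01 iu).
Qed.

Lemma V_sqint u : integ I u -> sq_integrable (fun t => V u t).
Proof.
move=> iu; apply: sqint_bounded; first exact: V_meas.
by move=> t /I01_itv It; exact: V_bound.
Qed.

Lemma is_derive_expRZ (c s : R) : is_derive s 1 (fun t => expR (c * t)) (c * expR (c * s)).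
Proof.
have -> : (fun t => expR (c * t)) = expR \o (fun t : R => c * t) by [].
apply: is_derive_eq. by rewrite /GRing.scale/=; ring.
Qed.

Lemma continuous_expRZ (c : R) : continuous (fun t => expR (c * t)).
Proof. exact: is_derive_continuous (is_derive_expRZ c). Qed.

(* Multiplying by the integrating factor [expR (- t / l)] turns [l u - V u]
   into an exact derivative. *)
Lemma V_integrating_factor u (l t : R) : l != 0 -> 0 <= t <= 1 -> integ I u ->
  \int[mu]_(s in `[0, t]) (expR (- l^-1 * s) * (l * u s - V u s)) =
  l * expR (- l^-1 * t) * V u t.
Proof.
move=> l0 It iu; have /andP[t0 t1] := It.
pose Phi s := - l * expR (- l^-1 * s).
have dPhi (s : R) : is_derive s 1 Phi (expR (- l^-1 * s)).
  have -> : expR (- l^-1 * s) = - l * (- l^-1 * expR (- l^-1 * s)).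
    by rewrite mulrA mulrNN mulfV// mul1r.
  by have := is_deriveZ (- l) (is_derive_expRZ (- l^-1) s).
have ce := @continuous_expRZ (- l^-1).
have ieu := integ_sub (lexx 0) t1 (integ_contM ce iu).
have iV := integ_sub (lexx 0) t1 (integ_contM ce (sqint_integ (V_sqint iu))).
have it := integ_sub (lexx 0) t1 iu.
under eq_Rintegral do rewrite mulrBr mulrCA.
rewrite RintegralB//; last exact: integZ.
rewrite (volterra_parts It ce dPhi iu) /Phi -RintegralB//.
- under eq_Rintegral => s _.
    have -> : l * (expR (- l^-1 * s) * u s) -
      (- l * expR (- l^-1 * t) - - l * expR (- l^-1 * s)) * u s =
      (l * expR (- l^-1 * t)) * u s by ring.
    over.
  by rewrite RintegralZl.
- exact: integZ.
- apply: (@eq_integrable _ _ R mu _ _ (EFin \o (fun s =>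
    (- l * expR (- l^-1 * t)) * u s - (- l) * (expR (- l^-1 * s) * u s)))) => //.
    by move=> s _ /=; congr EFin; ring.
  by apply: integB => //; apply: integZ.
Qed.

(** On [0,1] the integrating factor e^(-s/l) is at most 1, and dividing it out at t costs at most
    e^(1/l). The positive real l here is to be the modulus of the complex parameter. *)
Lemma V_gronwall u g (l t : R) : 0 < l -> 0 <= t <= 1 -> integ I u -> integ I g ->
  (forall s, I s -> 0 <= g s) ->
  (forall s, I s -> l * u s - V u s <= g s) ->
  V u t <= l^-1 * expR l^-1 * \int[mu]_(s in I) g s.
Proof.
move=> l0 It iu ig g0 ug; have /andP[t0 t1] := It.
have ce := @continuous_expRZ (- l^-1).
have li : 0 < l^-1 by rewrite invr_gt0.
have H : l * expR (- l^-1 * t) * V u t <= \int[mu]_(s in I) g s.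
  rewrite -V_integrating_factor ?gt_eqF//.
  apply: le_trans (le_V_I01 It ig g0).
  apply: le_Rintegral => //.
  - apply: integ_sub => //; apply: integ_contM => //.
    by apply: integB => //; [exact: integZ|exact: sqint_integ (V_sqint iu)].
  - exact: integ_sub.
  move=> s; rewrite /= in_itv/= => /andP[s0 st].
  have Is : I s by apply/I01_itv; rewrite s0 (le_trans st).
  apply: le_trans (_ : expR (- l^-1 * s) * g s <= _).
    by rewrite ler_wpM2l ?expR_ge0// ug.
  rewrite ler_piMl ?g0// expR_le1; nra.
have g_ge0 : 0 <= \int[mu]_(s in I) g s by exact: Rintegral_ge0.
have -> : V u t = l^-1 * expR (l^-1 * t) * (l * expR (- l^-1 * t) * V u t).
  rewrite mulNr expRN; field.
  by rewrite gt_eqF ?expR_gt0// gt_eqF.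
apply: le_trans (_ : l^-1 * expR (l^-1 * t) * \int[mu]_(s in I) g s <= _).
  by rewrite ler_wpM2l// mulr_ge0 ?expR_ge0// ltW.
rewrite ler_wpM2r// ler_wpM2l ?(ltW li)// ler_expR; nra.
Qed.

(** * The modulus of a complex function and a pointwise resolvent estimate *)

Definition cmod f t : R := Num.sqrt (f.1 t ^+ 2 + f.2 t ^+ 2).

Lemma cmod_ge0 f t : 0 <= cmod f t. Proof. exact: sqrtr_ge0. Qed.

Lemma cmod_sqr f t : cmod f t ^+ 2 = f.1 t ^+ 2 + f.2 t ^+ 2.
Proof. by rewrite sqr_sqrtr// addr_ge0 ?sqr_ge0. Qed.

(** Cauchy-Schwarz in the plane, from the Lagrange identity with remainder (a d - b c)^2. *)
Lemma dot_le (a b c d : R) :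
  a * c + b * d <= Num.sqrt (a ^+ 2 + b ^+ 2) * Num.sqrt (c ^+ 2 + d ^+ 2).
Proof.
rewrite -sqrtrM ?addr_ge0 ?sqr_ge0//.
apply: le_trans (ler_norm _) _; rewrite -sqrtr_sqr; apply: ler_wsqrtr.
by have := sqr_ge0 (a * d - b * c); nra.
Qed.

Lemma meas_cmod f : measurable_fun I f.1 -> measurable_fun I f.2 ->
  measurable_fun I (cmod f).
Proof.
move=> m1 m2; apply: (measurableT_comp (f := @Num.sqrt R)).
  by apply: continuous_measurable_fun; exact: sqrt_continuous.
by apply: measurable_funD; exact: measurable_funX.
Qed.

Lemma L2_integ_sq f : L2 f -> integ I (fun t => f.1 t ^+ 2 + f.2 t ^+ 2).
Proof. by move=> [h1 h2]; apply: integD => //; exact: sqint_integ_sq. Qed.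

Lemma L2_cmod f : L2 f -> sq_integrable (cmod f).
Proof.
move=> hf; apply: integ_sq_sqint.
  by case: hf => h1 h2; apply: meas_cmod; exact: sqint_meas.
apply: (@eq_integrable _ _ R mu _ mI _ _ _ (L2_integ_sq hf)) => t _.
by rewrite /= cmod_sqr.
Qed.

Lemma L2norm_ge0 f : 0 <= L2norm f. Proof. exact: sqrtr_ge0. Qed.

Lemma L2norm_sqr f : L2norm f ^+ 2 = \int[mu]_(t in I) (cmod f t ^+ 2).
Proof.
rewrite sqr_sqrtr; first by apply: eq_Rintegral => t _; rewrite cmod_sqr.
by apply: Rintegral_ge0 => t _; rewrite addr_ge0 ?sqr_ge0.
Qed.

Definition residual l y : cfun R := csub (Defs.cscale l y) (volterra y).

Lemma L2_residual l y : L2 y -> L2 (residual l y).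
Proof.
move=> [h1 h2]; have V1 := V_sqint (sqint_integ h1); have V2 := V_sqint (sqint_integ h2).
split.
  rewrite (_ : (residual l y).1 =
    fun t => 1 * (l.1 * y.1 t + (- l.2) * y.2 t) + (-1) * V y.1 t).
    by apply: sqint_lin => //; exact: sqint_lin.
  by apply/funext => t; rewrite /residual/=; ring.
rewrite (_ : (residual l y).2 =
    fun t => 1 * (l.1 * y.2 t + l.2 * y.1 t) + (-1) * V y.2 t).
  by apply: sqint_lin => //; exact: sqint_lin.
by apply/funext => t; rewrite /residual/=; ring.
Qed.

Lemma cmod_cscale l y t : cmod (Defs.cscale l y) t = cabs l * cmod y t.
Proof.
rewrite /cmod /cabs -sqrtrM ?addr_ge0 ?sqr_ge0//; congr Num.sqrt.
by rewrite /=; ring.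
Qed.

(* Pairing [(l - V) y] with [l y] reduces the complex problem to a real
   Gronwall inequality for the modulus of [y]. *)
Lemma cmod_residual l y t : L2 y -> 0 <= t <= 1 ->
  cabs l * cmod y t - V (cmod y) t <= cmod (residual l y) t.
Proof.
move=> hy It; have /andP[t0 t1] := It; have [h1 h2] := hy.
set w := Defs.cscale l y.
have i1 := integ_sub (lexx 0) t1 (sqint_integ h1).
have i2 := integ_sub (lexx 0) t1 (sqint_integ h2).
have iu := integ_sub (lexx 0) t1 (sqint_integ (L2_cmod hy)).
have V0 : 0 <= V (cmod y) t by apply: Rintegral_ge0 => s _; exact: cmod_ge0.
rewrite -cmod_cscale -/w lerBlDr.
have Vle : w.1 t * V y.1 t + w.2 t * V y.2 t <= cmod w t * V (cmod y) t.
  rewrite -!RintegralZl// -RintegralD//; [|exact: integZ|exact: integZ].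
  apply: le_Rintegral => //.
  - by apply: integD => //; exact: integZ.
  - exact: integZ.
  - by move=> s _; exact: dot_le.
have xle := dot_le (w.1 t) (w.2 t) ((residual l y).1 t) ((residual l y).2 t).
have w0 := cmod_ge0 w t; have r0 := cmod_ge0 (residual l y) t.
have [->|wn0] := eqVneq (cmod w t) 0; first by rewrite addr_ge0.
have wp : 0 < cmod w t by rewrite lt_neqAle eq_sym wn0.
rewrite -(ler_pM2l wp) -expr2 cmod_sqr mulrDr.
(* Since the residual is w - V y, the square |w|^2 is the sum of the pairings of w with the residual
   and with V y; one factor |w| is then cancelled. *)
apply: le_trans (lerD xle Vle).
rewrite /residual /w /=.
set a := V y.1 t; set b := V y.2 t; nra.
Qed.

(** Gronwall with u = |y| and g = |residual| replaces the term V |y| by a constant. *)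
Lemma resolvent_pointwise l y t : 0 < cabs l -> L2 y -> I t ->
  cabs l * cmod y t <= cmod (residual l y) t +
    (cabs l)^-1 * expR (cabs l)^-1 * \int[mu]_(s in I) cmod (residual l y) s.
Proof.
move=> l0 hy /I01_itv It.
rewrite -lerBlDr; apply: le_trans (cmod_residual l hy It); rewrite lerD2l lerN2.
apply: V_gronwall => //.
- exact: sqint_integ (L2_cmod hy).
- exact: sqint_integ (L2_cmod (L2_residual l hy)).
- by move=> s _; exact: cmod_ge0.
- by move=> s /I01_itv Is; exact: cmod_residual.
Qed.

Lemma L2norm_ae f h : L2 f -> L2 h -> L2eq f h -> L2norm f = L2norm h.
Proof.
move=> hf hh fh; rewrite /L2norm; congr (Num.sqrt (fine _)).
apply: ae_eq_integral => //.
- exact: measurable_int (L2_integ_sq hf).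
- exact: measurable_int (L2_integ_sq hh).
by apply: (ae_impl _ fh) => t H It; have [-> ->] := H It.
Qed.

(** Integrates a <= (1 + a^2) / 2 over an interval of length 1. *)
Lemma integ_cmod_le f : L2 f -> L2norm f <= 1 -> \int[mu]_(t in I) cmod f t <= 1.
Proof.
move=> hf f1; have hm := L2_cmod hf.
apply: le_trans (_ : \int[mu]_(t in I) (2^-1 + 2^-1 * cmod f t ^+ 2) <= _).
  apply: le_Rintegral => //.
  - exact: sqint_integ.
  - apply: integD => //; first exact: integ_I01_cst.
    by apply: integZ => //; exact: sqint_integ_sq.
  - by move=> t _; have := sqr_ge0 (cmod f t - 1); nra.
rewrite RintegralD//; last 2 first.
- exact: integ_I01_cst.
- by apply: integZ => //; exact: sqint_integ_sq.
rewrite Rintegral_I01_cst RintegralZl//; last exact: sqint_integ_sq.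
rewrite -L2norm_sqr; have := L2norm_ge0 f; nra.
Qed.

(** With k = 1 / |l|, the pointwise estimate reads |y| <= k (|residual| + k e^k); this expression
    dominates the resulting L2 norm and keeps the rate e^k, all that matters later. *)
Definition op_bound (k : R) : R := 2 * (1 + k) ^+ 2 * expR k.

Lemma resolvent_bound l x y : 0 < cabs l -> L2 x -> L2norm x <= 1 ->
  res_sol (@volterra R) l x y -> L2norm y <= op_bound (cabs l)^-1.
Proof.
move=> l0 hx x1 [hy yx].
set k := (cabs l)^-1.
have k0 : 0 < k by rewrite invr_gt0.
have hr := L2_residual l hy.
have r1 : L2norm (residual l y) <= 1 by rewrite (L2norm_ae hr hx yx).
set K := k * expR k.
have K0 : 0 <= K by rewrite mulr_ge0 ?expR_ge0// ltW.
have yle t : I t -> cmod y t ^+ 2 <= 2 * k ^+ 2 * K ^+ 2 + 2 * k ^+ 2 * cmod (residual l y) t ^+ 2.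
  move=> It; have := resolvent_pointwise l0 hy It.
  rewrite -/k -/K => H.
  have {}H : cmod y t <= k * (cmod (residual l y) t + K).
    rewrite -ler_pdivrMl ?invr_gt0// invrK.
    apply: le_trans H _; rewrite lerD2l; apply: ler_piMr => //.
    exact: integ_cmod_le.
  have := cmod_ge0 y t; have := cmod_ge0 (residual l y) t.
  move: H; set a := cmod y t; set b := cmod _ t => H b0 a0.
  have : a ^+ 2 <= (k * (b + K)) ^+ 2 by rewrite lerXn2r ?nnegrE// mulr_ge0 ?addr_ge0// ltW.
  move/le_trans; apply.
  have := mulr_ge0 (sqr_ge0 k) (sqr_ge0 (b - K)); nra.
have : L2norm y ^+ 2 <= 2 * k ^+ 2 * K ^+ 2 + 2 * k ^+ 2 * L2norm (residual l y) ^+ 2.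
  have iy := sqint_integ_sq (L2_cmod hy); have ir := sqint_integ_sq (L2_cmod hr).
  rewrite !L2norm_sqr -RintegralZl// -[X in X + _]Rintegral_I01_cst -RintegralD//; last 2 first.
  - exact: integ_I01_cst.
  - exact: integZ.
  apply: le_Rintegral => //.
  by apply: integD; [|exact: integ_I01_cst|exact: integZ].
have r0 := L2norm_ge0 (residual l y).
have e1 : 1 <= expR k by rewrite -expR0 ler_expR ltW.
move=> H; rewrite -(@ler_pXn2r _ 2)// ?nnegrE ?L2norm_ge0//; last first.
  by rewrite /op_bound mulr_ge0 ?expR_ge0// mulr_ge0// sqr_ge0.
apply: le_trans H _; rewrite /op_bound /K.
set e := expR k in e1 *; set r := L2norm _ in r0 r1 *.
have r2 : r ^+ 2 <= 1 by rewrite exprn_ile1.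
have e2 : 1 <= e ^+ 2 by rewrite exprn_ege1.
apply: le_trans (_ : 2 * k ^+ 2 * (k * e) ^+ 2 + 2 * k ^+ 2 * e ^+ 2 <= _).
  rewrite lerD2l ler_wpM2l//; last exact: le_trans e2.
  by rewrite mulr_ge0// sqr_ge0.
have -> : 2 * k ^+ 2 * (k * e) ^+ 2 + 2 * k ^+ 2 * e ^+ 2 = (2 * k ^+ 4 + 2 * k ^+ 2) * e ^+ 2 by ring.
rewrite exprMn ler_wpM2r ?sqr_ge0//.
have -> : (2 * (1 + k) ^+ 2) ^+ 2 = 4 * (1 + 4 * k + 6 * k ^+ 2 + 4 * k ^+ 3 + k ^+ 4) by ring.
have := exprn_ge0 2 (ltW k0); have := exprn_ge0 3 (ltW k0); have := exprn_ge0 4 (ltW k0).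
lra.
Qed.

(** The difference d of two solutions has residual zero almost everywhere, and the pointwise
    estimate then forces |l| |d| <= 0 there. *)
Lemma resolvent_unique l x y y' : 0 < cabs l ->
  res_sol (@volterra R) l x y -> res_sol (@volterra R) l x y' -> L2norm y = L2norm y'.
Proof.
move=> l0 [hy yx] [hy' yx'].
have hd : L2 (csub y y').
  have [a b] := hy; have [a' b'] := hy'.
  have c u v : sq_integrable u -> sq_integrable v -> sq_integrable (fun t => u t - v t).
    move=> hu hv; rewrite (_ : (fun _ => _) = fun t => 1 * u t + (-1) * v t).
      exact: sqint_lin.
    by apply/funext => t; rewrite mul1r mulN1r.
  by split; apply: c.
set d := csub y y' in hd *.
have d0 : {ae mu, forall t, I t -> cmod (residual l d) t = 0}.
  apply: (@filterS2 _ _ (ae_filter_ringOfSetsType mu) _ _ _ _ yx yx') => t H H' It; have [e1 e2] := H It; have [e1' e2'] := H' It.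
  have /I01_itv/andP[t0 t1] := It.
  have [a b] := hy; have [a' b'] := hy'.
  have Vd1 : V d.1 t = V y.1 t - V y'.1 t.
    by rewrite -RintegralB//; apply: integ_sub => //; exact: sqint_integ.
  have Vd2 : V d.2 t = V y.2 t - V y'.2 t.
    by rewrite -RintegralB//; apply: integ_sub => //; exact: sqint_integ.
  apply/eqP; rewrite -sqrf_eq0 cmod_sqr /residual /= Vd1 Vd2.
  move: e1 e2 e1' e2' => /= e1 e2 e1' e2'; apply/eqP.
  have -> : l.1 * (y.1 t - y'.1 t) - l.2 * (y.2 t - y'.2 t) - (V y.1 t - V y'.1 t) = 0.
    by move: (etrans e1 (esym e1')); lra.
  have -> : l.1 * (y.2 t - y'.2 t) + l.2 * (y.1 t - y'.1 t) - (V y.2 t - V y'.2 t) = 0.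
    by move: (etrans e2 (esym e2')); lra.
  by rewrite expr0n/= addr0.
have i0 : \int[mu]_(s in I) cmod (residual l d) s = 0.
  rewrite /Rintegral (@ae_eq_integral _ _ R mu _ (cst 0%E)) ?integral0//.
  - exact: measurable_int (sqint_integ (L2_cmod (L2_residual l hd))).
  - by apply: (ae_impl _ d0) => t H It; rewrite /= H.
apply: L2norm_ae => //; apply: (ae_impl _ d0) => t H It.
have := resolvent_pointwise l0 hd It; rewrite i0 H// mulr0 addr0 pmulr_rle0// => d_le0.
have : cmod d t ^+ 2 = 0 by have := cmod_ge0 d t; nra.
rewrite cmod_sqr /d/= => E0.
have := sqr_ge0 (y.1 t - y'.1 t); have := sqr_ge0 (y.2 t - y'.2 t) => s1 s2.
have z1 : (y.1 t - y'.1 t) ^+ 2 = 0 by lra.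
have z2 : (y.2 t - y'.2 t) ^+ 2 = 0 by lra.
by move/eqP: z1; move/eqP: z2; rewrite !sqrf_eq0 !subr_eq0 => /eqP-> /eqP->.
Qed.

Lemma res_vec_normE l x y : 0 < cabs l -> res_sol (@volterra R) l x y ->
  res_vec_norm (@volterra R) l x = L2norm y.
Proof.
move=> l0 hy; rewrite /res_vec_norm (_ : [set L2norm _ | _ in _] = [set L2norm y]) ?sup1//.
apply/seteqP; split => [_ [y' hy' <-]|_ ->] /=; last by exists y.
exact: resolvent_unique hy' hy.
Qed.

(** A value by convention: [sup] of the empty set is 0. *)
Lemma res_vec_norm_none l x : ~ (exists y, res_sol (@volterra R) l x y) ->
  res_vec_norm (@volterra R) l x = 0.
Proof.
move=> no; rewrite /res_vec_norm (_ : [set L2norm _ | _ in _] = set0) ?sup0//.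
by apply/seteqP; split => [_ [y' hy' <-]|//]; apply: no; exists y'.
Qed.

(** [resolvent_bound] makes the set bounded above, so that [sup] is a genuine supremum. *)
Lemma res_op_norm_ge l x y : 0 < cabs l -> L2 x -> L2norm x <= 1 ->
  res_sol (@volterra R) l x y -> L2norm y <= res_op_norm (@volterra R) l.
Proof.
move=> l0 hx x1 hy; apply: ub_le_sup; last by exists y => //; exists x.
exists (op_bound (cabs l)^-1) => _ [y' [x' [hx' [x1' hy']]] <-].
exact: resolvent_bound hy'.
Qed.

Lemma res_op_norm_le l : 0 < cabs l ->
  res_op_norm (@volterra R) l <= op_bound (cabs l)^-1.
Proof.
move=> l0; have op0 : 0 <= op_bound (cabs l)^-1.
  by rewrite /op_bound mulr_ge0 ?expR_ge0// mulr_ge0// sqr_ge0.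
rewrite /res_op_norm; set S := [set L2norm _ | _ in _].
have [->|/set0P S0] := eqVneq S set0; first by rewrite sup0.
apply: ge_sup => // _ [y' [x' [hx' [x1' hy']]] <-].
exact: resolvent_bound hy'.
Qed.

End Resolvent.

(** * Explicit resolvents: lower bound for the operator norm, and k_x <= 1 *)

Section Explicit.
Variable R : realType.
Local Notation mu := (@lebesgue_measure R).
Local Notation I := (@I01 R).
Local Notation integ D u := (mu.-integrable D (EFin \o u)).
Local Notation V u t := (Rintegral mu `[0, t]%classic u).
Local Notation opnorm := (res_op_norm (@volterra R)).
Local Notation vecnorm := (res_vec_norm (@volterra R)).
Implicit Types (u v g : R -> R) (a t : R) (x y f : cfun R) (l : cscalar R).

Let mI := @measurable_I01 R.

(* Real and imaginary parts of [1 / l]. *)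
Definition re_inv l : R := l.1 / cabs l ^+ 2.
Definition im_inv l : R := - l.2 / cabs l ^+ 2.

Lemma cabs_sqr l : cabs l ^+ 2 = l.1 ^+ 2 + l.2 ^+ 2.
Proof. by rewrite sqr_sqrtr// addr_ge0 ?sqr_ge0. Qed.

Lemma cabs_inv_real z : 0 < z -> cabs (z^-1, 0) = z^-1 :> R.
Proof.
by move=> z0; rewrite /cabs /= expr0n addr0 sqrtr_sqr gtr0_norm// invr_gt0.
Qed.

Lemma inv_re l : 0 < cabs l -> l.1 * re_inv l - l.2 * im_inv l = 1.
Proof.
move=> l0; rewrite /re_inv /im_inv.
have -> : l.1 * (l.1 / cabs l ^+ 2) - l.2 * (- l.2 / cabs l ^+ 2) =
  (l.1 ^+ 2 + l.2 ^+ 2) / cabs l ^+ 2 by ring.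
by rewrite -cabs_sqr divff// sqrf_eq0 gt_eqF.
Qed.

Lemma inv_im l : l.1 * im_inv l + l.2 * re_inv l = 0.
Proof. by rewrite /re_inv /im_inv; ring. Qed.

Lemma inv_sqr l : 0 < cabs l -> re_inv l ^+ 2 + im_inv l ^+ 2 = (cabs l)^-1 ^+ 2.
Proof.
move=> l0; rewrite /re_inv /im_inv.
have -> : (l.1 / cabs l ^+ 2) ^+ 2 + (- l.2 / cabs l ^+ 2) ^+ 2 =
  (l.1 ^+ 2 + l.2 ^+ 2) * (cabs l ^+ 2)^-1 ^+ 2 by ring.
by rewrite -cabs_sqr; field; rewrite gt_eqF.
Qed.

Lemma norm_re_inv_le l : 0 < cabs l -> `|re_inv l| <= (cabs l)^-1.
Proof.
move=> l0; rewrite -(@ler_pXn2r _ 2)// ?nnegrE ?invr_ge0 ?(ltW l0)//.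
by rewrite real_normK ?num_real// -inv_sqr// lerDl sqr_ge0.
Qed.

(** Real part of e^((p + i q) t); [expsin] is the imaginary part. *)
Definition expcos (p q t : R) : R := expR (p * t) * cos (q * t).
Definition expsin (p q t : R) : R := expR (p * t) * sin (q * t).

Lemma is_derive_cosZ (c s : R) : is_derive s 1 (fun t => cos (c * t)) (- (c * sin (c * s))).
Proof.
have -> : (fun t => cos (c * t)) = cos \o (fun t : R => c * t) by [].
by apply: is_derive_eq; rewrite /GRing.scale/=; ring.
Qed.

Lemma is_derive_sinZ (c s : R) : is_derive s 1 (fun t => sin (c * t)) (c * cos (c * s)).
Proof.
have -> : (fun t => sin (c * t)) = sin \o (fun t : R => c * t) by [].
by apply: is_derive_eq; rewrite /GRing.scale/=; ring.
Qed.

Lemma is_derive_expcos (p q s : R) :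
  is_derive s 1 (expcos p q) (p * expcos p q s - q * expsin p q s).
Proof.
have h := is_deriveM (is_derive_expRZ p s) (is_derive_cosZ q s).
rewrite [X in is_derive _ _ X _](_ : _ = (fun t => expR (p * t)) * (fun t => cos (q * t)))//.
by apply: (is_derive_eq h); rewrite /GRing.scale/= /expcos /expsin; ring.
Qed.

Lemma is_derive_expsin (p q s : R) :
  is_derive s 1 (expsin p q) (p * expsin p q s + q * expcos p q s).
Proof.
have h := is_deriveM (is_derive_expRZ p s) (is_derive_sinZ q s).
rewrite [X in is_derive _ _ X _](_ : _ = (fun t => expR (p * t)) * (fun t => sin (q * t)))//.
by apply: (is_derive_eq h); rewrite /GRing.scale/= /expcos /expsin; ring.
Qed.

Lemma continuous_expcos (p q : R) : continuous (expcos p q).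
Proof. exact: is_derive_continuous (is_derive_expcos p q). Qed.

Lemma continuous_expsin (p q : R) : continuous (expsin p q).
Proof. exact: is_derive_continuous (is_derive_expsin p q). Qed.

Lemma continuous_lin (c d : R) u v : continuous u -> continuous v ->
  continuous (fun t => c * u t + d * v t).
Proof.
move=> cu cv t; apply: cvgD; apply: cvgM; try exact: cvg_cst; [exact: cu|exact: cv].
Qed.

Lemma expcos_sqr (p q t : R) : expcos p q t ^+ 2 + expsin p q t ^+ 2 = expR (2 * p * t).
Proof.
rewrite /expcos /expsin !exprMn -mulrDr cos2Dsin2 mulr1 -expRM_natl.
by congr expR; ring.
Qed.

Lemma expcos0 (p q : R) : expcos p q 0 = 1.
Proof. by rewrite /expcos !mulr0 expR0 cos0 mulr1. Qed.

Lemma expsin0 (p q : R) : expsin p q 0 = 0.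
Proof. by rewrite /expsin !mulr0 sin0 mulr0. Qed.

Definition one_fun : cfun R := (fun=> 1, fun=> 0).

(* [z e^(z t)] with [z = 1 / l] *)
Definition one_sol l : cfun R :=
  let p := re_inv l in let q := im_inv l in
  (fun t => p * expcos p q t + (- q) * expsin p q t,
   fun t => p * expsin p q t + q * expcos p q t).

Lemma L2_cont f : continuous f.1 -> continuous f.2 -> L2 f.
Proof. by move=> c1 c2; split; exact: sqint_cont. Qed.

Lemma L2eq_I01 f (h : cfun R) :
  (forall t, I t -> f.1 t = h.1 t /\ f.2 t = h.2 t) -> L2eq f h.
Proof. by move=> fh; apply: aeW => t; exact: fh. Qed.

Lemma L2_one_fun : L2 one_fun.
Proof. by apply: L2_cont => t; exact: cst_continuous. Qed.

Lemma L2norm_one_fun : L2norm one_fun <= 1.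
Proof.
rewrite /L2norm (_ : Rintegral _ _ _ = 1) ?sqrtr1//.
by rewrite -[RHS](@Rintegral_I01_cst R); apply: eq_Rintegral => t _ /=; ring.
Qed.

Lemma one_sol_res l : 0 < cabs l -> res_sol (@volterra R) l one_fun (one_sol l).
Proof.
move=> l0; set p := re_inv l; set q := im_inv l.
have cE := @continuous_expcos p q; have cS := @continuous_expsin p q.
have c1 : continuous (one_sol l).1 by exact: continuous_lin.
have c2 : continuous (one_sol l).2 by exact: continuous_lin.
split; first exact: L2_cont.
apply: L2eq_I01 => t /I01_itv/andP[t0 t1] /=.
have e1 := @inv_re l l0; have e2 := inv_im l.
(* [one_sol] is the derivative of e^(z t), so V maps it to e^(z t) - 1, while l times it is e^(z
   t). *)
have dE (s : R) : is_derive s 1 (expcos p q) ((one_sol l).1 s).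
  by have := is_derive_expcos p q s; rewrite /= mulNr.
have dS (s : R) : is_derive s 1 (expsin p q) ((one_sol l).2 s).
  exact: is_derive_expsin.
rewrite (FTC2 t0 c1 dE) (FTC2 t0 c2 dS).
rewrite expcos0 expsin0 -/p -/q; rewrite -/p -/q in e1 e2.
split.
  have -> : l.1 * (p * expcos p q t + (- q) * expsin p q t) -
      l.2 * (p * expsin p q t + q * expcos p q t) - (expcos p q t - 1) =
    (l.1 * p - l.2 * q) * expcos p q t - (l.1 * q + l.2 * p) * expsin p q t
      - (expcos p q t - 1) by ring.
  by rewrite e1 e2; ring.
have -> : l.1 * (p * expsin p q t + q * expcos p q t) +
    l.2 * (p * expcos p q t + (- q) * expsin p q t) - (expsin p q t - 0) =
  (l.1 * p - l.2 * q) * expsin p q t + (l.1 * q + l.2 * p) * expcos p q t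
    - expsin p q t by ring.
by rewrite e1 e2; ring.
Qed.

Lemma cmod_one_sol l t : 0 < cabs l ->
  cmod (one_sol l) t ^+ 2 = (cabs l)^-1 ^+ 2 * expR (2 * re_inv l * t).
Proof.
move=> l0; rewrite cmod_sqr -(@expcos_sqr _ (im_inv l)) -inv_sqr// /=.
by ring.
Qed.

(** Used mostly on an interval of length |l| at the end of [0,1] where an explicit solution peaks;
    this costs only a factor polynomial in |l|. *)
Lemma L2norm_ge_itv f (a b c : R) : L2 f -> 0 <= a -> a <= b -> b <= 1 ->
  (forall t, a <= t <= b -> c <= cmod f t ^+ 2) -> c * (b - a) <= L2norm f ^+ 2.
Proof.
move=> hf a0 ab b1 cf; have iq := sqint_integ_sq (L2_cmod hf).
rewrite L2norm_sqr; apply: le_trans (_ : \int[mu]_(t in `[a, b]) cmod f t ^+ 2 <= _).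
  have -> : c * (b - a) = \int[mu]_(t in `[a, b]) c.
    by rewrite (@Rintegral_cst _ _ R mu) ?[X in fine X]mu_itvcc.
  apply: le_Rintegral => //.
  - by apply: cont_integ => t; exact: cst_continuous.
  - exact: integ_sub.
rewrite -lee_fin -!EFin_Rintegral//; last exact: integ_sub.
apply: ge0_subset_integral => //.
- exact: measurable_int iq.
- by move=> t _; rewrite lee_fin sqr_ge0.
- exact: sub_I01.
Qed.

Lemma L2norm_le f (M : R) : L2 f -> 0 <= M ->
  (forall t, I t -> cmod f t ^+ 2 <= M ^+ 2) -> L2norm f <= M.
Proof.
move=> hf M0 fM; rewrite -(@ler_pXn2r _ 2)// ?nnegrE ?L2norm_ge0//.
rewrite L2norm_sqr -(@Rintegral_I01_cst R (M ^+ 2)); apply: le_Rintegral => //.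
- exact: sqint_integ_sq (L2_cmod hf).
- exact: integ_I01_cst.
Qed.

(** The function |z|^2 e^(2 t Re z) peaks at t = 1 if Re z >= 0 and at t = 0 otherwise. Within
    distance |l| of the peak the exponent drops by at most 2, as |Re z| |l| <= 1; one of the two
    factors 1 / |l| is spent on the length of the interval. *)
Lemma one_sol_ge l : 0 < cabs l <= 1 ->
  (cabs l)^-1 * expR (2 * Num.max (re_inv l) 0 - 2) <= L2norm (one_sol l) ^+ 2.
Proof.
move=> /andP[l0 l1]; have [hy _] := one_sol_res l0.
have pk := norm_re_inv_le l0.
set k := (cabs l)^-1 in pk *; set p := re_inv l in pk *.
have k0 : 0 < k by rewrite invr_gt0.
have lk : cabs l * k = 1 by rewrite mulfV// gt_eqF.
have [p0|p0] := leP 0 p.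
  have -> : k * expR (2 * p - 2) = (k ^+ 2 * expR (2 * p - 2)) * (1 - (1 - cabs l)).
    rewrite (_ : 1 - (1 - cabs l) = cabs l); last by ring.
    by rewrite -[LHS]mul1r -lk; ring.
  apply: L2norm_ge_itv => //; [by rewrite subr_ge0|by rewrite gerBl ltW|].
  move=> t /andP[t1 t2]; rewrite cmod_one_sol// -/k -/p ler_wpM2l ?sqr_ge0//.
  rewrite ler_expR; move: pk; rewrite ger0_norm// => pk.
  have : p * (1 - t) <= k * cabs l by apply: ler_pM => //; lra.
  by rewrite mulrC in lk; rewrite lk; nra.
rewrite mulr0 add0r.
have -> : k * expR (- 2) = (k ^+ 2 * expR (- 2)) * (cabs l - 0).
  by rewrite subr0 -[LHS]mul1r -lk; ring.
apply: L2norm_ge_itv => //; first exact: ltW.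
move=> t /andP[t1 t2]; rewrite cmod_one_sol// -/k -/p ler_wpM2l ?sqr_ge0//.
rewrite ler_expR; move: pk; rewrite ltr0_norm// => pk.
have : (- p) * t <= k * cabs l by apply: ler_pM => //; lra.
by rewrite mulrC in lk; rewrite lk; nra.
Qed.

Lemma expR2 (a : R) : expR a ^+ 2 = expR (2 * a).
Proof. by rewrite -expRM_natl. Qed.

(** The smallness of l gives 1 / |l| >= e^(2 W + 2), where the 2 pays for the loss of e^(-2) in
    [one_sol_ge]; the square root leaves e^W e^((Re z)^+). *)
Lemma ln_opnorm_ge l (W : R) : 0 <= W -> 0 < cabs l < expR (- (2 * W + 2)) ->
  W + Num.max (re_inv l) 0 <= ln (opnorm l).
Proof.
move=> W0 /andP[l0 lW].
have l1 : cabs l <= 1.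
  by apply: le_trans (ltW lW) _; rewrite expR_le1; lra.
set P := Num.max _ _.
have H : expR (W + P) <= opnorm l.
  apply: le_trans (res_op_norm_ge l0 L2_one_fun L2norm_one_fun (one_sol_res l0)).
  rewrite -(@ler_pXn2r _ 2)// ?nnegrE ?L2norm_ge0 ?expR_ge0//.
  apply: le_trans (one_sol_ge _); last by rewrite l0 l1.
  rewrite expR2 -/P.
  have -> : 2 * (W + P) = (2 * W + 2) + (2 * P - 2) by ring.
  rewrite expRD ler_wpM2r ?expR_ge0//.
  rewrite -[leLHS]invrK -expRN lef_pV2 ?posrE ?expR_gt0//.
  exact: ltW.
rewrite -(expRK (W + P)) ler_ln ?posrE ?expR_gt0//.
by apply: lt_le_trans H; exact: expR_gt0.
Qed.

(** [ln] is 0 on nonpositive arguments, where the bound reads 0 <= b. *)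
Lemma ln_le_exp (v b : R) : 0 <= b -> v <= expR b -> ln v <= b.
Proof.
move=> b0 vb; have [v0|v0] := leP v 0; first by rewrite ln0.
by rewrite -(expRK b) ler_ln ?posrE ?expR_gt0.
Qed.

Lemma kx_le x (c : R) : (forall e : R, 0 < e -> exists2 d : R, 0 < d &
    forall l, 0 < cabs l < d -> ln (vecnorm l x) / ln (opnorm l) <= c + e) ->
  (kx (@volterra R) x <= c%:E)%E.
Proof.
move=> H; apply/lee_addgt0Pr => e e0; have [d d0 Hd] := H e e0.
apply: ge_ereal_inf; exists (ereal_sup
  [set ((ln (vecnorm l x) / ln (opnorm l))%:E)%E | l in [set l | 0 < cabs l < d]]).
  by exists d.
by apply: ge_ereal_sup => _ [l ld <-]; rewrite -EFinD lee_fin; exact: Hd.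
Qed.

Lemma kx_ge x (c : R) : (forall d e : R, 0 < d -> 0 < e -> exists2 l,
    0 < cabs l < d & c - e <= ln (vecnorm l x) / ln (opnorm l)) ->
  (c%:E <= kx (@volterra R) x)%E.
Proof.
move=> H; apply: le_ereal_inf_tmp => _ [d d0 <-].
apply/lee_subgt0Pr => e e0; have [l ld Hl] := H d e d0 e0.
apply: le_ereal_sup_tmp; exists ((ln (vecnorm l x) / ln (opnorm l))%:E)%E.
  by exists l.
by rewrite -EFinB lee_fin.
Qed.

(** The operator norm is a supremum over the unit ball, so x and its solution are rescaled by 1 /
    ||x||; if there is no solution, the left side is 0. *)
Lemma vecnorm_le l x : 0 < cabs l -> L2 x -> L2norm x <> 0 ->
  vecnorm l x <= opnorm l * L2norm x.
Proof.
move=> l0 hx x0.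
have xp : 0 < L2norm x by rewrite lt_neqAle L2norm_ge0 andbT eq_sym; exact/eqP.
have N0 : 0 <= opnorm l.
  apply: le_trans (L2norm_ge0 (one_sol l)) _.
  exact: res_op_norm_ge l0 L2_one_fun L2norm_one_fun (one_sol_res l0).
have [[y hy]|no] := pselect (exists y, res_sol (@volterra R) l x y); last first.
  by rewrite res_vec_norm_none// mulr_ge0// ltW.
rewrite (res_vec_normE l0 hy).
pose c := (L2norm x)^-1; have c0 : 0 < c by rewrite invr_gt0.
pose sc f : cfun R := (fun t => c * f.1 t, fun t => c * f.2 t).
have L2sc f : L2 f -> L2 (sc f).
  have sqZ u : sq_integrable u -> sq_integrable (fun t => c * u t).
    move=> hu; rewrite (_ : (fun t => c * u t) = fun t => c * u t + 0 * u t).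
      exact: sqint_lin.
    by apply/funext => t; rewrite mul0r addr0.
  by move=> [h1 h2]; split; exact: sqZ.
have normsc f : L2 f -> L2norm (sc f) = c * L2norm f.
  move=> hf; rewrite /L2norm /=; under eq_Rintegral do rewrite !exprMn -mulrDr.
  rewrite RintegralZl//; last exact: L2_integ_sq.
  by rewrite sqrtrM ?sqr_ge0// sqrtr_sqr gtr0_norm.
rewrite -ler_pdivrMr// mulrC -/c -normsc; last by case: hy.
have [hL2 hxy] := hy.
apply: (@res_op_norm_ge _ l (sc x)) => //; first exact: L2sc.
  by rewrite normsc// mulVf// gt_eqF.
split; first exact: L2sc.
apply: ae_impl hxy => t H It; have [e1 e2] := H It; have /I01_itv/andP[t0 t1] := It.
have [h1 h2] := hL2.
move: e1 e2 => /= e1 e2; rewrite !RintegralZl//; last 2 first.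
- exact: integ_sub (sqint_integ h2).
- exact: integ_sub (sqint_integ h1).
by rewrite -e1 -e2; split; ring.
Qed.

Lemma kx_le1 x : L2 x -> L2norm x <> 0 -> (kx (@volterra R) x <= 1)%E.
Proof.
move=> hx x0; apply: kx_le => e e0.
(* Then e times the logarithm of the operator norm is at least e W >= n, which absorbs the term ln
   ||x|| left by [vecnorm_le]. *)
pose n : R := `|ln (L2norm x)|; pose W : R := 1 + n / e.
have n0 : 0 <= n by exact: normr_ge0.
have W0 : 0 < W by rewrite ltr_pwDl// divr_ge0// ltW.
exists (expR (- (2 * W + 2))); first exact: expR_gt0.
move=> l lW; have l0 : 0 < cabs l by case/andP: lW.
have lnN : W <= ln (opnorm l).
  apply: le_trans (ln_opnorm_ge (ltW W0) lW).
  by rewrite lerDl le_max lexx orbT.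
have lnN0 : 0 < ln (opnorm l) by exact: lt_le_trans lnN.
rewrite ler_pdivrMr//.
have N0 : 0 < opnorm l.
  by rewrite ltNge; apply/negP => /ln0 N0; rewrite N0 ltxx in lnN0.
have en : n <= e * ln (opnorm l).
  apply: le_trans (_ : e * W <= _); last by rewrite ler_pM2l.
  by rewrite /W mulrDr mulr1 mulrCA mulfV ?gt_eqF// mulr1 lerDr ltW.
have xp : 0 < L2norm x by rewrite lt_neqAle L2norm_ge0 andbT eq_sym; exact/eqP.
have [v0|v0] := leP (vecnorm l x) 0.
  by rewrite ln0// mulr_ge0 ?(ltW lnN0)// addr_ge0// ltW.
apply: le_trans (_ : ln (opnorm l * L2norm x) <= _).
  by rewrite ler_ln ?posrE ?mulr_gt0//; exact: vecnorm_le.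
rewrite lnM ?posrE// mulrDl mul1r lerD2l.
by apply: le_trans en; exact: ler_norm.
Qed.

(** * Ramps: every r in (0,1] is a value of k_x *)

Definition ramp a t : R := Num.max (t - a) 0.
Definition ramp_fun a : cfun R := (ramp a, fun=> 0).
(* [e^(z (t - a)^+) - 1] with [z = 1 / l] *)
Definition ramp_sol a l : cfun R :=
  let p := re_inv l in let q := im_inv l in
  (fun t => expcos p q (ramp a t) - 1, fun t => expsin p q (ramp a t)).

Lemma continuous_ramp a : continuous (ramp a).
Proof.
move=> t; apply: (@continuous_max _ R^o (fun t : R => t - a) (fun=> 0)).
  by apply: cvgB; [exact: cvg_id|exact: cvg_cst].
exact: cst_continuous.
Qed.

(** As u 0 = 0, the integrand vanishes up to a; from a on it is a translate of u, to which the
    fundamental theorem applies. *)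
Lemma Rintegral_ramp a t u (U : R -> R) : 0 <= a -> 0 <= t -> continuous u ->
  (forall s : R, is_derive s 1 U (u s)) -> u 0 = 0 -> U 0 = 0 ->
  \int[mu]_(s in `[0, t]) u (ramp a s) = U (ramp a t).
Proof.
move=> a0 t0 cu dU u0 U0.
have small s b : s <= a -> \int[mu]_(r in `[b, s]) u (ramp a r) = 0.
  move=> sa; rewrite (@eq_Rintegral _ _ R mu _ (cst 0)).
    by rewrite /Rintegral integral0.
  move=> r; rewrite mem_itvcc => /andP[_ rs].
  by rewrite /ramp max_r ?u0// subr_le0 (le_trans rs).
have [ta|ta] := leP t a.
  by rewrite small// /ramp max_r ?subr_le0// U0.
have cur : continuous (u \o ramp a).
  by move=> s; apply: continuous_comp; [exact: continuous_ramp|exact: cu].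
have := @Rintegral_itvB R (u \o ramp a) (BLeft 0) (BRight t) a.
rewrite (small a 0)// subr0 /= => ->; rewrite ?bnd_simp//; last 2 first.
- exact: cont_integ.
- exact: ltW.
rewrite Rintegral_itv_obnd_cbnd; last first.
  apply: (@integrableS _ _ R mu `[a, t]) => //; last exact: cont_integ.
  exact: subset_itv_oc_cc.
have cus : continuous (fun s => u (s - a)).
  move=> s; apply: (@continuous_comp _ _ _ (fun s : R => s - a) u); last exact: cu.
  by apply: cvgB; [exact: cvg_id|exact: cvg_cst].
rewrite (@eq_Rintegral _ _ R mu _ (fun s => u (s - a))); last first.
  move=> s; rewrite mem_itvcc => /andP[sa _].
  by rewrite /= /ramp max_l// subr_ge0.
have dUs (s : R) : is_derive s 1 (fun s => U (s - a)) (u (s - a)).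
  have -> : (fun s => U (s - a)) = U \o (fun s : R => s - a) by [].
  have h := dU (s - a).
  have h1 : is_derive s 1 (fun s : R => s - a) 1.
    by apply: is_derive_eq; rewrite subr0.
  by have := is_derive1_comp (f := U) (g := fun s : R => s - a) h h1; rewrite mulr1.
rewrite (FTC2 (ltW ta) cus dUs).
by rewrite subrr U0 subr0 /ramp max_l// subr_ge0 ltW.
Qed.

Lemma continuous_expcos1 (p q : R) : continuous (fun s => expcos p q s - 1).
Proof.
by move=> s; apply: cvgB; [exact: continuous_expcos|exact: cvg_cst].
Qed.

Lemma ramp_sol_cont a l : continuous (ramp_sol a l).1 /\ continuous (ramp_sol a l).2.
Proof.
split => s.
  apply: (@continuous_comp _ _ _ (ramp a) (fun r => expcos (re_inv l) (im_inv l) r - 1)).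
    exact: continuous_ramp.
  exact: continuous_expcos1.
apply: (@continuous_comp _ _ _ (ramp a) (expsin (re_inv l) (im_inv l))).
  exact: continuous_ramp.
exact: continuous_expsin.
Qed.

Lemma ramp_sol_res a l : 0 <= a -> 0 < cabs l ->
  res_sol (@volterra R) l (ramp_fun a) (ramp_sol a l).
Proof.
move=> a0 l0; set p := re_inv l; set q := im_inv l.
have [c1 c2] := ramp_sol_cont a l.
split; first exact: L2_cont.
have e1 := @inv_re l l0; have e2 := inv_im l; rewrite -/p -/q in e1 e2.
(* [G] and [H] are the real and imaginary parts of l (e^(z s) - 1) - s, the primitive of e^(z s) - 1
   vanishing at 0; subtracting it from l (e^(z s) - 1) leaves exactly the ramp s. *)
pose G (s : R) := l.1 * (expcos p q s - 1) - l.2 * expsin p q s - s.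
pose H (s : R) := l.1 * expsin p q s + l.2 * (expcos p q s - 1).
have dE1 (s : R) : is_derive s 1 (fun r => expcos p q r - 1) (p * expcos p q s - q * expsin p q s).
  have h := is_deriveB (is_derive_expcos p q s) (is_derive_cst (1 : R) s 1).
  by apply: (is_derive_eq h); rewrite subr0.
have dG (s : R) : is_derive s 1 G (expcos p q s - 1).
  have h := is_deriveB (is_deriveB (is_deriveZ l.1 (dE1 s))
    (is_deriveZ l.2 (is_derive_expsin p q s))) (is_derive_id s 1).
  apply: (is_derive_eq h); rewrite /GRing.scale/=.
  have -> : l.1 * (p * expcos p q s - q * expsin p q s) -
    l.2 * (p * expsin p q s + q * expcos p q s) - 1 =
    (l.1 * p - l.2 * q) * expcos p q s - (l.1 * q + l.2 * p) * expsin p q s - 1 by ring.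
  by rewrite e1 e2; ring.
have dH (s : R) : is_derive s 1 H (expsin p q s).
  have h := is_deriveD (is_deriveZ l.1 (is_derive_expsin p q s))
    (is_deriveZ l.2 (dE1 s)).
  apply: (is_derive_eq h); rewrite /GRing.scale/=.
  have -> : l.1 * (p * expsin p q s + q * expcos p q s) +
    l.2 * (p * expcos p q s - q * expsin p q s) =
    (l.1 * p - l.2 * q) * expsin p q s + (l.1 * q + l.2 * p) * expcos p q s by ring.
  by rewrite e1 e2; ring.
apply: L2eq_I01 => t /I01_itv/andP[t0 t1] /=.
rewrite (@Rintegral_ramp a t (fun r => expcos p q r - 1) G)//; last 3 first.
- exact: continuous_expcos1.
- by rewrite expcos0 subrr.
- by rewrite /G expcos0 expsin0; ring.
rewrite (@Rintegral_ramp a t (expsin p q) H)//; last 3 first.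
- exact: continuous_expsin.
- exact: expsin0.
- by rewrite /H expcos0 expsin0; ring.
by rewrite /G /H -/p -/q; split; ring.
Qed.

Lemma ramp_fun_L2 a : L2 (ramp_fun a).
Proof.
by apply: L2_cont; [exact: continuous_ramp|move=> t; exact: cst_continuous].
Qed.

(** The triangle inequality |e^w - 1| <= e^(Re w) + 1 in squared form; both terms are at most e^((Re
    z)^+ (1 - a)). *)
Lemma ramp_sol_le a l : 0 <= a <= 1 -> 0 < cabs l ->
  L2norm (ramp_sol a l) <= 2 * expR (Num.max (re_inv l) 0 * (1 - a)).
Proof.
move=> /andP[a0 a1] l0; have [hy _] := ramp_sol_res a0 l0.
set p := re_inv l; set q := im_inv l; set P := Num.max p 0.
have P0 : 0 <= P by rewrite le_max lexx orbT.
have pP : p <= P by rewrite le_max lexx.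
apply: L2norm_le => //.
move=> t /I01_itv/andP[t0 t1]; set s := ramp a t.
have s0 : 0 <= s by rewrite le_max lexx orbT.
have s1 : s <= 1 - a by rewrite ge_max lerD2r t1 subr_ge0.
have e1 : expR (p * s) <= expR (P * (1 - a)).
  rewrite ler_expR; apply: le_trans (_ : P * s <= _); first exact: ler_wpM2r.
  exact: ler_wpM2l.
have e2 : 1 <= expR (P * (1 - a)).
  by rewrite -[leLHS]expR0 ler_expR mulr_ge0// subr_ge0.
have e3 : cmod (ramp_sol a l) t ^+ 2 = expR (p * s) ^+ 2 - 2 * expcos p q s + 1.
  rewrite cmod_sqr /= -/s -/p -/q expR2 mulrA -(expcos_sqr p q); ring.
have e4 : - expcos p q s <= expR (p * s).
  by rewrite /expcos; have := cos_geN1 (q * s); have := expR_ge0 (p * s); nra.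
rewrite e3; have := expR_ge0 (p * s); nra.
Qed.

(** On the last stretch of length 1 / z the exponent z (t - a) is at least z (1 - a) - 1. Giving up
    one more unit pays for the -1 in e^w - 1, since e A - 1 >= A for A >= 1; hence the shift by
    2. *)
Lemma ramp_sol_ge a (z : R) : 0 <= a -> 1 <= z -> 2 <= z * (1 - a) ->
  expR (2 * (z * (1 - a) - 2)) <= z * L2norm (ramp_sol a (z^-1, 0)) ^+ 2.
Proof.
move=> a0 z1 zr; have z0 : 0 < z by apply: lt_le_trans z1.
set l := (z^-1, 0).
have lE : cabs l = z^-1 by exact: cabs_inv_real.
have l0 : 0 < cabs l by rewrite lE invr_gt0.
have pE : re_inv l = z by rewrite /re_inv lE /=; field; rewrite gt_eqF.
have qE : im_inv l = 0 by rewrite /im_inv /= oppr0 mul0r.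
have [hy _] := ramp_sol_res a0 l0.
have zi0 : 0 <= z^-1 by rewrite invr_ge0 ltW.
have zi1 : z^-1 <= 1 by rewrite invf_le1.
have zz : z * z^-1 = 1 by rewrite mulfV// gt_eqF.
have e1 : 1 <= expR 1 - 1 :> R by have := expR_ge1Dx (1 : R); lra.
have : expR (2 * (z * (1 - a) - 2)) * (1 - (1 - z^-1)) <= L2norm (ramp_sol a l) ^+ 2.
  apply: L2norm_ge_itv => //; [by rewrite subr_ge0|by rewrite gerBl|].
  move=> t /andP[t1 t2]; rewrite cmod_sqr /= pE qE -expR2.
  apply: le_trans (_ : (expcos z 0 (ramp a t) - 1) ^+ 2 <= _); last by rewrite lerDl sqr_ge0.
  have ze : 0 <= expR (z * (1 - a) - 2) by exact: expR_ge0.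
  suff H : expR (z * (1 - a) - 2) <= expcos z 0 (ramp a t) - 1 by nra.
  rewrite /expcos mul0r cos0 mulr1.
  have z2 : 1 <= expR (z * (1 - a) - 2) by rewrite -[leLHS]expR0 ler_expR; lra.
  have : expR (1 + (z * (1 - a) - 2)) <= expR (z * ramp a t).
    rewrite ler_expR; have : t - a <= ramp a t by rewrite le_max lexx.
    nra.
  rewrite expRD; nra.
have -> : 1 - (1 - z^-1) = z^-1 by ring.
by rewrite ler_pdivrMr// [X in _ <= X]mulrC.
Qed.

(** The cubic term (h z)^3 / 6 of the exponential series is at least 8 z^2 once h^3 z >= 48, and 2
    (1 + z)^2 <= 8 z^2 for z >= 1. *)
Lemma quadratic_le_expR (z h : R) : 0 < h -> 1 <= z -> 48 / h ^+ 3 <= z ->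
  2 * (1 + z) ^+ 2 <= expR (h * z).
Proof.
move=> h0 z1 hz.
have z0 : 0 < z by apply: lt_le_trans z1.
have hz0 : 0 <= h * z by rewrite mulr_ge0// ltW.
apply: le_trans (expR_ge1Dxn 2 hz0).
have -> : 3`!%:R = 6 :> R by [].
have h3 : 0 < h ^+ 3 by rewrite exprn_gt0.
rewrite ler_pdivrMr// in hz.
have : 48 * z ^+ 2 <= z * h ^+ 3 * z ^+ 2 by rewrite ler_wpM2r ?sqr_ge0.
have -> : (h * z) ^+ 3 / 6 = z * h ^+ 3 * z ^+ 2 / 6 by ring.
nra.
Qed.

Lemma op_bound_le (z h : R) : 0 < h -> 1 <= z -> 48 / h ^+ 3 <= z ->
  op_bound z <= expR ((1 + h) * z).
Proof.
move=> h0 z1 hz; rewrite (_ : (1 + h) * z = h * z + z); last by ring.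
by rewrite expRD /op_bound ler_wpM2r ?expR_ge0//; exact: quadratic_le_expR.
Qed.

Lemma opnorm_real_le (z h : R) : 0 < h -> 1 <= z -> 48 / h ^+ 3 <= z ->
  opnorm (z^-1, 0) <= expR ((1 + h) * z).
Proof.
move=> h0 z1 hz; have z0 : 0 < z by apply: lt_le_trans z1.
apply: le_trans (op_bound_le h0 z1 hz).
have lE : cabs (z^-1, 0) = z^-1 by exact: cabs_inv_real.
have := @res_op_norm_le R (z^-1, 0); rewrite lE invrK; apply.
by rewrite invr_gt0.
Qed.

Lemma kx_ramp (r : R) : 0 < r <= 1 -> kx (@volterra R) (ramp_fun (1 - r)) = r%:E.
Proof.
move=> /andP[r0 r1]; set a := 1 - r.
have a0 : 0 <= a by rewrite subr_ge0.
have a1 : a <= 1 by rewrite gerBl ltW.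
have ar : 1 - a = r by rewrite /a; ring.
apply/eqP; rewrite eq_le; apply/andP; split.
  (* [e * W] is 1 and covers the constant 1 of the numerator, which comes from the factor 2 <= expR
     1 of [ramp_sol_le]. *)
  apply: kx_le => e e0; pose W := 1 / e.
  have W0 : 0 < W by rewrite divr_gt0.
  exists (expR (- (2 * W + 2))); first exact: expR_gt0.
  move=> l lW; have l0 : 0 < cabs l by case/andP: lW.
  have lnN := ln_opnorm_ge (ltW W0) lW.
  set P := Num.max _ _ in lnN.
  have P0 : 0 <= P by rewrite le_max lexx orbT.
  have lnN0 : 0 < ln (opnorm l) by apply: lt_le_trans lnN; rewrite ltr_wpDr.
  rewrite ler_pdivrMr//.
  apply: le_trans (_ : (r + e) * (W + P) <= _); last by rewrite ler_wpM2l// addr_ge0// ltW.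
  apply: le_trans (_ : 1 + P * r <= _).
    apply: ln_le_exp; first by rewrite addr_ge0// mulr_ge0// ltW.
    rewrite (res_vec_normE l0 (ramp_sol_res a0 l0)).
    apply: le_trans (ramp_sol_le _ l0) _; first by rewrite a0 a1.
    rewrite expRD ar ler_wpM2r ?expR_ge0//.
    by have := expR_ge1Dx (1 : R); lra.
  have eW : e * W = 1 by rewrite /W mulrC divfK// gt_eqF.
  have := mulr_ge0 (ltW r0) (ltW W0); have := mulr_ge0 (ltW e0) P0; nra.
apply: kx_ge => d e d0 e0.
(* h <= r / 2 keeps r - 2 h nonnegative, h <= e / 2 makes it at least r - e, and (r - 2 h) (1 + h)
   <= r - h because r <= 1. *)
pose h : R := Num.min (e / 2) (r / 2).
have h0 : 0 < h by rewrite lt_min !divr_gt0.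
have he : h <= e / 2 by rewrite ge_min lexx.
have hr : h <= r / 2 by rewrite ge_min lexx orbT.
(* A sum, so that z exceeds every threshold at once: 48 / h^3 for the operator norm, 4 / h and 2 / r
   for the lower bound on the solution, d^-1 for 1 / z < d, expR 4 for [ln_opnorm_ge] with W = 1. *)
pose z : R := 2 + 48 / h ^+ 3 + 4 / h + 2 / r + d^-1 + expR 4.
have p1 : 0 <= 48 / h ^+ 3 by rewrite divr_ge0// exprn_ge0// ltW.
have p2 : 0 <= 4 / h by rewrite divr_ge0// ltW.
have p3 : 0 <= 2 / r by rewrite divr_ge0// ltW.
have p4 : 0 < d^-1 by rewrite invr_gt0.
have p5 : 0 < expR 4 :> R by exact: expR_gt0.
have z2 : 2 <= z by rewrite /z; lra.
have z0 : 0 < z by lra.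
have z1 : 1 <= z by lra.
have hz : 48 / h ^+ 3 <= z by rewrite /z; lra.
have zh : 4 <= h * z by rewrite mulrC -ler_pdivrMr// /z; lra.
have zr : 2 <= z * (1 - a) by rewrite ar -ler_pdivrMr// /z; lra.
have zd : d^-1 < z by rewrite /z; lra.
have ze : expR 4 < z by rewrite /z; lra.
have lE : cabs (z^-1, 0) = z^-1 by exact: cabs_inv_real.
have l0 : 0 < cabs (z^-1, 0) by rewrite lE invr_gt0.
exists (z^-1, 0).
  by rewrite l0 lE -[d]invrK ltf_pV2 ?posrE.
have lnN : 1 <= ln (opnorm (z^-1, 0)).
  have -> : 1 = 1 + 0 :> R by rewrite addr0.
  apply: le_trans (_ : 1 + Num.max (re_inv (z^-1, 0)) 0 <= _).
    by rewrite lerD2l le_max lexx orbT.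
  apply: ln_opnorm_ge => //; rewrite l0 lE expRN ltf_pV2 ?posrE ?expR_gt0//.
  by rewrite (_ : 2 * 1 + 2 = 4 :> R)//; ring.
have lnNle : ln (opnorm (z^-1, 0)) <= (1 + h) * z.
  by apply: ln_le_exp; [rewrite mulr_ge0//; lra|exact: opnorm_real_le].
rewrite ler_pdivlMr; last by lra.
apply: le_trans (_ : (r - 2 * h) * ln (opnorm (z^-1, 0)) <= _).
  by rewrite ler_wpM2r//; lra.
apply: le_trans (_ : (r - 2 * h) * ((1 + h) * z) <= _).
  by rewrite ler_wpM2l//; lra.
apply: le_trans (_ : (r - h) * z <= _).
  by rewrite mulrA ler_wpM2r ?(ltW z0)//; nra.
rewrite (res_vec_normE l0 (ramp_sol_res a0 l0)).
have H := ramp_sol_ge a0 z1 zr; rewrite ar in H.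
(* The spare exponent 2 h z absorbs both the factor z and the loss of 4 in [ramp_sol_ge]. *)
have z8 : z <= expR (2 * (h * z) - 4).
  apply: le_trans (_ : expR (h * z) <= _); last by rewrite ler_expR; lra.
  by have := quadratic_le_expR h0 z1 hz; have := sqr_ge0 z; nra.
have H2 : expR (2 * ((r - h) * z)) <= L2norm (ramp_sol a (z^-1, 0)) ^+ 2.
  rewrite -(ler_pM2l z0); apply: le_trans H.
  apply: le_trans (_ : expR (2 * (h * z) - 4) * expR (2 * ((r - h) * z)) <= _).
    by rewrite ler_wpM2r// expR_ge0.
  by rewrite -expRD ler_expR; lra.
have H3 : expR ((r - h) * z) <= L2norm (ramp_sol a (z^-1, 0)).
  by rewrite -(@ler_pXn2r _ 2)// ?nnegrE ?expR_ge0 ?L2norm_ge0// expR2.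
rewrite -(expRK ((r - h) * z)) ler_ln ?posrE ?expR_gt0//.
by apply: lt_le_trans H3; exact: expR_gt0.
Qed.

Lemma L2norm_ramp_neq0 a : 0 <= a < 1 -> L2norm (ramp_fun a) <> 0.
Proof.
move=> /andP[a0 a1] n0.
pose b := (a + 1) / 2.
have : (b - a) ^+ 2 * (1 - b) <= L2norm (ramp_fun a) ^+ 2.
  apply: L2norm_ge_itv => //; [exact: ramp_fun_L2|rewrite /b; lra|rewrite /b; lra|].
  move=> t /andP[t1 t2]; rewrite cmod_sqr /= expr0n/= addr0.
  have : t - a <= ramp a t by rewrite le_max lexx.
  by move: t1; rewrite /b; nra.
rewrite n0 expr0n/= /b => H.
have : 0 < (((a + 1) / 2 - a) ^+ 2 * (1 - (a + 1) / 2)).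
  by rewrite mulr_gt0 ?exprn_gt0//; lra.
lra.
Qed.

End Explicit.

(** * Positivity of k_x for nonzero x *)

Section Positivity.
Variable R : realType.
Local Notation mu := (@lebesgue_measure R).
Local Notation I := (@I01 R).
Local Notation integ D u := (mu.-integrable D (EFin \o u)).
Local Notation V u t := (Rintegral mu `[0, t]%classic u).
Local Notation opnorm := (res_op_norm (@volterra R)).
Local Notation vecnorm := (res_vec_norm (@volterra R)).
Implicit Types (u v g : R -> R) (c t z : R) (x y : cfun R).

Let mI := @measurable_I01 R.

Definition expV z u t : R := V (fun s => expR (- z * s) * u s) t.
(* [z u + z^2 int_0^t e^(z (t - s)) u(s) ds], the resolvent at [l = 1 / z] *)
Definition real_res z u t : R := z * u t + z * (z * expR (z * t) * expV z u t).

Lemma integ_expM z u : integ I u -> integ I (fun s => expR (- z * s) * u s).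
Proof. by move=> iu; apply: integ_contM => //; exact: continuous_expRZ. Qed.

(** [volterra_parts] with Phi = e^(z s) / z exchanges the two integrations; the term in V u that it
    produces cancels the one coming from z u. *)
Lemma V_real_res z u t : 0 < z -> 0 <= t <= 1 -> integ I u ->
  V (real_res z u) t = z * expR (z * t) * expV z u t.
Proof.
move=> z0 It iu; have /andP[t0 t1] := It; have zn : z != 0 by rewrite gt_eqF.
pose Phi s := z^-1 * expR (z * s).
have dPhi (s : R) : is_derive s 1 Phi (expR (z * s)).
  have -> : expR (z * s) = z^-1 * (z * expR (z * s)) by rewrite mulrA mulVf// mul1r.
  by have := is_deriveZ z^-1 (is_derive_expRZ z s).
have ce := @continuous_expRZ R z.
have ieu := integ_expM z iu.
have iV := integ_contM ce (sqint_integ (V_sqint ieu)).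
have it := integ_sub (lexx 0) t1 iu.
have iet := integ_sub (lexx 0) t1 ieu.
have iVt := integ_sub (lexx 0) t1 iV.
rewrite /real_res.
under eq_Rintegral => s _ do rewrite -mulrA (mulrA z z).
rewrite RintegralD//; [|exact: integZ|by apply: integZ => //; exact: iVt].
rewrite !RintegralZl// (volterra_parts It ce dPhi ieu).
have -> : \int[mu]_(s in `[0, t]) ((Phi t - Phi s) * (expR (- z * s) * u s)) =
    z^-1 * expR (z * t) * expV z u t - z^-1 * V u t.
  rewrite -!RintegralZl// -RintegralB//; [|exact: integZ|exact: integZ].
  apply: eq_Rintegral => s _; rewrite /Phi mulrBl; congr (_ - _).
  by rewrite -mulrA; congr (_ * _); rewrite mulrA mulNr expRN mulfV ?mul1r// gt_eqF ?expR_gt0.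
by field.
Qed.

Lemma real_res_sqint z u : sq_integrable u -> sq_integrable (real_res z u).
Proof.
move=> hu; apply: sqint_lin => //.
have [M HM] := cont_bound 0 1 (@continuous_expRZ R z).
have ieu := integ_expM z (sqint_integ hu).
apply: (@sqint_bounded _ _ (`|z| * M * \int[mu]_(s in I) `|expR (- z * s) * u s|)).
  apply: measurable_funM; last exact: V_meas.
  apply: measurable_funM; first exact: measurable_cst.
  by apply: cont_meas; exact: continuous_expRZ.
move=> t /I01_itv It; rewrite !normrM ler_pM ?mulr_ge0//.
  by rewrite ler_wpM2l//; exact: HM.
exact: V_bound.
Qed.

Lemma real_res_sol z x : 0 < z -> L2 x ->
  res_sol (@volterra R) (z^-1, 0) x (real_res z x.1, real_res z x.2).
Proof.
move=> z0 [h1 h2]; split; first by split; exact: real_res_sqint.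
have zn : z != 0 by rewrite gt_eqF.
apply: L2eq_I01 => t /I01_itv It /=.
rewrite !V_real_res//; try exact: sqint_integ.
by rewrite /real_res; split; field.
Qed.

(** For the solution y, V y at 1 is z e^z times the Laplace integral of x, and it is at most the
    integral of the modulus, hence at most 1 + ||y||^2. Squaring the norm only doubles an
    exponential rate that is arbitrary anyway. *)
Lemma V1_real_res_le z x : 0 < z -> L2 x ->
  `|z * expR z * expV z x.1 1| <= 1 + vecnorm (z^-1, 0) x ^+ 2 /\
  `|z * expR z * expV z x.2 1| <= 1 + vecnorm (z^-1, 0) x ^+ 2.
Proof.
move=> z0 hx; have lE : 0 < cabs (z^-1, 0).
  by rewrite /cabs /= expr0n addr0 sqrtr_sqr normr_gt0 invr_eq0 gt_eqF.
have hy := real_res_sol z0 hx; rewrite (res_vec_normE lE hy).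
have [hy2 _] := hy; have [h1 h2] := hx.
set y := (real_res z x.1, real_res z x.2) in hy hy2 *.
have I1 : (0 <= (1 : R)) && ((1 : R) <= 1) by rewrite ler01 lexx.
have main u : sq_integrable u -> (forall t, `|real_res z u t| <= 1 + cmod y t ^+ 2) ->
    `|z * expR z * expV z u 1| <= 1 + L2norm y ^+ 2.
  move=> hu uy; have iq := sqint_integ_sq (L2_cmod hy2).
  have ir := sqint_integ (real_res_sqint z hu).
  have := V_real_res z0 I1 (sqint_integ hu); rewrite mulr1 => <-.
  apply: le_trans (V_bound I1 ir) _.
  rewrite L2norm_sqr -{1}[1](@Rintegral_I01_cst R) -RintegralD//; last exact: integ_I01_cst.
  apply: le_Rintegral => //; first exact: integ_norm.
  by apply: integD => //; exact: integ_I01_cst.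
split; apply: main => // t; apply: le_trans (norm_le_sqr _) _.
  by rewrite lerD2l cmod_sqr lerDl sqr_ge0.
by rewrite lerD2l cmod_sqr lerDr sqr_ge0.
Qed.

(* If [k_x <= 0], then on the positive real axis the resolvent of [x] is
   subexponential in [1 / l], while [ln] of the operator norm is at most [2 / l]. *)
Lemma kx_small_growth x c : L2 x -> 0 < c -> (kx (@volterra R) x <= 0)%E ->
  exists2 z0 : R, 0 <= z0 & forall z, z0 <= z ->
    `|expR z * expV z x.1 1| <= 2 * expR (c * z) /\
    `|expR z * expV z x.2 1| <= 2 * expR (c * z).
Proof.
move=> hx c0 k0.
(* c / 4 because the logarithm of the operator norm is at most 2 z: the solution then has rate c /
   2, and its square rate c. *)
have : (kx (@volterra R) x < (c / 4)%:E)%E.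
  by apply: le_lt_trans k0 _; rewrite lte_fin divr_gt0.
move=> /ereal_inf_lt[_ [d d0 <-]] hd.
have p4 : 0 < d^-1 by rewrite invr_gt0.
have p5 : 0 < expR 4 :> R by exact: expR_gt0.
(* 48 is the threshold of [opnorm_real_le] with h = 1, expR 4 that of [ln_opnorm_ge] with W = 1, and
   d^-1 puts 1 / z below d. *)
pose z0 : R := 48 + d^-1 + expR 4 + 1.
have z00 : 0 <= z0 by rewrite /z0; lra.
exists z0 => // z zz; have z1 : 1 <= z by move: zz; rewrite /z0; lra.
have zp : 0 < z by lra.
have z48 : 48 <= z by move: zz; rewrite /z0; lra.
have zd : d^-1 < z by move: zz; rewrite /z0; lra.
have ze : expR 4 < z by move: zz; rewrite /z0; lra.
have lE : cabs (z^-1, 0) = z^-1 by exact: cabs_inv_real.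
have l0 : 0 < cabs (z^-1, 0) by rewrite lE invr_gt0.
have ld : 0 < cabs (z^-1, 0) < d.
  by rewrite l0 lE -[d]invrK ltf_pV2 ?posrE.
have ratio : ln (vecnorm (z^-1, 0) x) / ln (opnorm (z^-1, 0)) <= c / 4.
  rewrite -lee_fin; apply: le_trans (ltW hd); apply: ereal_sup_ubound.
  by exists (z^-1, 0).
have lnN : 1 <= ln (opnorm (z^-1, 0)).
  have -> : 1 = 1 + 0 :> R by rewrite addr0.
  apply: le_trans (_ : 1 + Num.max (re_inv (z^-1, 0)) 0 <= _).
    by rewrite lerD2l le_max lexx orbT.
  apply: ln_opnorm_ge => //; rewrite l0 lE expRN ltf_pV2 ?posrE ?expR_gt0//.
  by rewrite (_ : 2 * 1 + 2 = 4 :> R)//; ring.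
have lnNle : ln (opnorm (z^-1, 0)) <= 2 * z.
  apply: ln_le_exp; first by lra.
  have := @opnorm_real_le R z 1; rewrite expr1n divr1 (_ : 1 + 1 = 2 :> R); last by ring.
  by apply.
have vle : vecnorm (z^-1, 0) x <= expR (c / 2 * z).
  have [v0|v0] := leP (vecnorm (z^-1, 0) x) 0.
    exact: le_trans v0 (expR_ge0 _).
  rewrite -ler_ln ?posrE ?expR_gt0// expRK.
  move: ratio; rewrite ler_pdivrMr; last by lra.
  move=> /le_trans; apply.
  apply: le_trans (_ : c / 4 * (2 * z) <= _); last by lra.
  by rewrite ler_wpM2l//; lra.
have hy := real_res_sol zp hx.
have v0 : 0 <= vecnorm (z^-1, 0) x by rewrite (res_vec_normE l0 hy) L2norm_ge0.
have v2 : 1 + vecnorm (z^-1, 0) x ^+ 2 <= 2 * expR (c * z).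
  have e2 : 1 <= expR (c * z) by rewrite -[leLHS]expR0 ler_expR mulr_ge0//; lra.
  have e3 : expR (c / 2 * z) ^+ 2 = expR (c * z) by rewrite expR2; congr expR; field.
  have : vecnorm (z^-1, 0) x ^+ 2 <= expR (c / 2 * z) ^+ 2.
    by rewrite lerXn2r ?nnegrE// expR_ge0.
  rewrite e3; lra.
have drop (w : R) : `|z * expR z * w| <= 1 + vecnorm (z^-1, 0) x ^+ 2 ->
    `|expR z * w| <= 2 * expR (c * z).
  move=> H; apply: le_trans v2; apply: le_trans H.
  by rewrite -mulrA [leRHS]normrM (gtr0_norm zp) ler_peMl.
by have [b1 b2] := V1_real_res_le zp hx; split; exact: drop.
Qed.

Lemma Rintegral_cvg (fn : nat -> R -> R) (f g : R -> R) :
  (forall n, measurable_fun I (fn n)) -> measurable_fun I f ->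
  {ae mu, forall t, I t -> fn ^~ t @ \oo --> f t} ->
  integ I g -> (forall n t, I t -> `|fn n t| <= g t) ->
  (fun n => Rintegral mu I (fn n)) @ \oo --> Rintegral mu I f.
Proof.
move=> mfn mf cf ig fg.
have mE (v : R -> R) : measurable_fun I v -> measurable_fun I (EFin \o v).
  by move/measurable_EFinP.
have cE : {ae mu, forall t, I t -> (fun n => (fn n t)%:E) @ \oo --> (f t)%:E}.
  apply: ae_impl cf => t h It; apply/fine_cvgP; split; first exact: nearW.
  exact: h It.
have dE : {ae mu, forall t n, I t -> (`|(fn n t)%:E| <= (g t)%:E)%E}.
  by apply: aeW => t n It; rewrite lee_fin; exact: fg.
have [if_ _ H] := @dominated_convergence _ _ R mu I mI (fun n => EFin \o fn n)
  (EFin \o f) (EFin \o g) (fun n => mE _ (mfn n)) (mE _ mf) cE ig dE.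
by apply: fine_cvg; rewrite -EFin_Rintegral.
Qed.

Lemma ae_neq (a : R) : {ae mu, forall t, t <> a}.
Proof.
exists [set a]; split; [exact: measurable_set1|exact: lebesgue_measure_set1|].
by move=> t /= /contrapT.
Qed.

Lemma series_exp_coeff_le (w : R) n : 0 <= w -> series (exp_coeff w) n <= expR w.
Proof.
move=> w0; apply: nondecreasing_cvgn_le; last exact: is_cvg_series_exp_coeff.
by apply: nondecreasing_series => k _ _; exact: exp_coeff_ge0.
Qed.

Lemma norm_series_exp_coeff_le (w : R) n : `|series (exp_coeff w) n| <= expR `|w|.
Proof.
apply: le_trans (series_exp_coeff_le n (normr_ge0 w)).
rewrite -normed_series_exp_coeff; exact: ler_norm_sum.
Qed.

(** * From slowly growing Laplace integrals to a vanishing primitive *)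

Section Mikusinski.
Variables (u : R -> R) (c C z0 T : R).
Hypothesis iu : integ I u.
Hypotheses (c0 : 0 <= c) (C0 : 0 <= C) (z00 : 0 <= z0) (T0 : 0 <= T) (Tc : T < 1 - c).
Hypothesis growth : forall z, z0 <= z ->
  `|\int[mu]_(s in I) (expR (z * (1 - s)) * u s)| <= C * expR (c * z).

Let X z s : R := expR (z * (T - s)).
(** Up to the factor C, the bound for the integral of [X z] times u: the growth e^(c z) times the
    shift e^(z (T - 1)). It decays because T < 1 - c. *)
Let del z : R := expR (z * (T - 1 + c)).

Let cX z : continuous (X z).
Proof.
have -> : X z = (fun s => expR (z * T) * expR (- z * s) + 0 * expR (- z * s)).
  by apply/funext => s; rewrite /X mul0r addr0 -expRD; congr expR; ring.
by apply: continuous_lin; exact: continuous_expRZ.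
Qed.

Let XX z s k : X z s ^+ k = X (k%:R * z) s.
Proof. by rewrite /X -expRM_natl mulrA. Qed.

Let del_X z k : del z ^+ k = del (k%:R * z).
Proof. by rewrite /del -expRM_natl mulrA. Qed.

Let X_int z : z0 <= z -> `|\int[mu]_(s in I) (X z s * u s)| <= C * del z.
Proof.
move=> zz; have -> : \int[mu]_(s in I) (X z s * u s) =
    expR (z * (T - 1)) * \int[mu]_(s in I) (expR (z * (1 - s)) * u s).
  rewrite -RintegralZl//; last first.
    apply: integ_contM => //.
    have -> : (fun s => expR (z * (1 - s))) =
        (fun s => expR z * expR (- z * s) + 0 * expR (- z * s)).
      by apply/funext => s; rewrite mul0r addr0 -expRD; congr expR; ring.
    by apply: continuous_lin; exact: continuous_expRZ.
  by apply: eq_Rintegral => s _; rewrite mulrA -expRD; congr (expR _ * _); ring.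
rewrite normrM (ger0_norm (expR_ge0 _)).
apply: le_trans (_ : expR (z * (T - 1)) * (C * expR (c * z)) <= _).
  by rewrite ler_wpM2l ?expR_ge0//; exact: growth.
rewrite mulrCA -expRD (_ : z * (T - 1) + c * z = z * (T - 1 + c))//; ring.
Qed.

(* Partial sums of [1 - exp (- X z s)]: its [k]-th term is a multiple of
   [X (k z) s], whose integral against [u] is controlled by [growth]. *)
Let S z K s : R := 1 - series (exp_coeff (- X z s)) K.+1.

(** [series] sums the indices strictly below its argument, so K.+1 keeps the terms 0 to K. *)
Let S0 z s : S z 0 s = 0.
Proof. by rewrite /S /series /= big_nat1 /exp_coeff /= expr0 divr1 subrr. Qed.

Let SS z K s : S z K.+1 s = S z K s + (- ((-1) ^+ K.+1 / K.+1`!%:R)) * X (K.+1%:R * z) s.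
Proof.
rewrite /S -XX /series /= big_nat_recr//= {2}/exp_coeff /= (exprNn (X z s)).
by set f := (_%:R)^-1; ring.
Qed.

Let cS z K : continuous (S z K).
Proof.
elim: K => [|K ih].
  have -> : S z 0 = fun=> 0 by apply/funext => s; exact: S0.
  by move=> s; exact: cst_continuous.
have -> : S z K.+1 = fun s => 1 * S z K s + (- ((-1) ^+ K.+1 / K.+1`!%:R)) * X (K.+1%:R * z) s.
  by apply/funext => s; rewrite SS mul1r.
exact: continuous_lin.
Qed.

(** Each new term is bounded through [growth] at k z, and del (k z) = (del z)^k reassembles these
    bounds into the exponential series of [del z] without its term of index 0. *)
Let S_int z K : z0 <= z ->
  `|\int[mu]_(s in I) (S z K s * u s)| <= C * (series (exp_coeff (del z)) K.+1 - 1).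
Proof.
move=> zz; elim: K => [|K ih].
  under eq_Rintegral do rewrite S0 mul0r.
  by rewrite Rintegral_I01_cst normr0 /series /= big_nat1 /exp_coeff /= expr0 divr1 subrr mulr0.
under eq_Rintegral do rewrite SS mulrDl -[X in _ + X]mulrA.
rewrite RintegralD//; last 2 first.
- exact: integ_contM.
- by apply: integZ => //; exact: integ_contM.
rewrite RintegralZl//; last exact: integ_contM.
apply: le_trans (ler_normD _ _) _.
have -> : C * (series (exp_coeff (del z)) K.+2 - 1) =
    C * (series (exp_coeff (del z)) K.+1 - 1) + (K.+1`!%:R)^-1 * (C * del (K.+1%:R * z)).
  rewrite -del_X /series /= big_nat_recr//= {2}/exp_coeff /=.
  by set f := (_%:R)^-1; ring.
apply: lerD => //.
rewrite normrM normrN normrM normrX normrN1 expr1n mul1r ger0_norm ?invr_ge0//.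
rewrite ler_wpM2l ?invr_ge0//; apply: X_int.
(* The terms start at k = 1, so k z >= z >= z0. *)
have z_ge0 : 0 <= z by exact: le_trans zz.
by rewrite (le_trans zz)// ler_peMl ?ler1n.
Qed.

(* As [z] grows, [phi z] tends to the indicator function of [s < T]. *)
Let phi z s : R := 1 - expR (- X z s).

Let cphi z : continuous (phi z).
Proof.
move=> s; apply: cvgB; first exact: cvg_cst.
apply: (@continuous_comp _ _ _ (fun s => - X z s) expR); last exact: continuous_expR.
by apply: cvgN; exact: cX.
Qed.

(** K tends to infinity under the integral; for z >= 0 and s in [0,1] the partial sums [S] are
    dominated by 1 + exp (e^(z T)). *)
Let phi_int z : z0 <= z ->
  `|\int[mu]_(s in I) (phi z s * u s)| <= C * (expR (del z) - 1).
Proof.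
move=> zz; have z_ge0 : 0 <= z by exact: le_trans zz.
have H : (fun K => \int[mu]_(s in I) (S z K s * u s)) @ \oo -->
    \int[mu]_(s in I) (phi z s * u s).
  apply: (@Rintegral_cvg _ _ (fun s => (1 + expR (expR (z * T))) * `|u s|)).
  - by move=> K; exact: integ_meas (integ_contM (cS (K := K)) iu).
  - exact: integ_meas (integ_contM (cphi (z := z)) iu).
  - apply: aeW => s _; apply: cvgM; last exact: cvg_cst.
    apply: cvgB; first exact: cvg_cst.
    have := is_cvg_series_exp_coeff (- X z s).
    by rewrite -/(cvgn _) /expR -(cvg_shiftS (series (exp_coeff (- X z s)))).
  - by apply: integZ => //; exact: integ_norm.
  move=> K s /I01_itv/andP[s0 s1]; rewrite normrM ler_wpM2r//.
  apply: le_trans (ler_normB _ _) _; rewrite normr1 lerD2l.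
  apply: le_trans (norm_series_exp_coeff_le _ _) _.
  rewrite normrN ger0_norm ?expR_ge0// !ler_expR.
  by rewrite ler_wpM2l// gerBl.
apply: (cvgr_to_le (cvg_norm H)); apply: nearW => K; apply: le_trans (S_int K zz) _.
by rewrite ler_wpM2l// lerD2r; apply: series_exp_coeff_le; exact: expR_ge0.
Qed.

Let zn (n : nat) : R := z0 + n%:R.

Let powcvg (d : R) : 0 < d -> (fun n : nat => expR (- d) ^+ n) @ \oo --> (0 : R).
Proof.
move=> d0; apply: cvg_expr; rewrite ger0_norm ?expR_ge0// expR_lt1.
by rewrite oppr_lt0.
Qed.

Let zn_le (d : R) n : 0 <= d -> expR (- (zn n * d)) <= expR (- d) ^+ n.
Proof.
move=> d0; rewrite -expRM_natl ler_expR mulrN lerN2 ler_wpM2r// /zn lerDr//.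
Qed.

(** The integrals of [phi z] times u tend to the integral of u over [0,T], by domination with |u|,
    and also to 0, because [del z] does. Only at s = T, where [X] is constantly 1, does [phi] miss
    the indicator; that point is null. *)
Lemma mikusinski : V u T = 0.
Proof.
have T1 : T <= 1 by have := c0; have := Tc; lra.
have cv : (fun n => \int[mu]_(s in I) (phi (zn n) s * u s)) @ \oo --> V u T.
  have -> : V u T = \int[mu]_(s in I) (\1_(`[0, T]) s * u s).
    rewrite Rintegral_mkcond [RHS]Rintegral_mkcond; apply: eq_Rintegral => s _.
    rewrite !patchE indicE mem_itvcc [s \in I]mem_itvcc.
    case: (boolP (0 <= s <= T)) => [/andP[s0 sT]|_].
      by rewrite s0 (le_trans sT)//= mul1r.
    by rewrite mul0r; case: ifP.
  apply: (@Rintegral_cvg _ _ (fun s => `|u s|)).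
  - by move=> n; exact: integ_meas (integ_contM (cphi (z := zn n)) iu).
  - apply: measurable_funM; last exact: integ_meas.
    exact: measurable_indic.
  - apply: ae_impl (ae_neq T) => s sT /I01_itv/andP[s0 s1].
    apply: cvgM; last exact: cvg_cst.
    rewrite indicE mem_itvcc s0 /=.
    (* For s < T, exp (- X) <= e^(- z (T - s)) since X >= z (T - s); for s > T, 1 - exp (- X) <= X =
       e^(- z (s - T)). *)
    have [sle|sgt] := leP s T.
      have d0 : 0 < T - s by rewrite subr_gt0 lt_neqAle sle andbT; apply/eqP.
      rewrite -[X in _ --> X]subr0; apply: cvgB; first exact: cvg_cst.
      apply: (@squeeze_cvgr _ _ _ _ (fun=> 0) (fun n => expR (- (T - s)) ^+ n)).
      + apply: nearW => n; rewrite expR_ge0/=.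
        apply: le_trans (zn_le n (ltW d0)); rewrite ler_expR lerN2 /X.
        by apply: le_trans (expR_ge1Dx _); rewrite lerDr.
      + exact: cvg_cst.
      + exact: powcvg.
    have d0 : 0 < s - T by rewrite subr_gt0.
    apply: (@squeeze_cvgr _ _ _ _ (fun=> 0) (fun n => expR (- (s - T)) ^+ n)).
    + apply: nearW => n; rewrite /phi subr_ge0 expR_le1 oppr_le0 expR_ge0/=.
      apply: le_trans (zn_le n (ltW d0)).
      have -> : expR (- (zn n * (s - T))) = X (zn n) s by rewrite /X; congr expR; ring.
      by have := expR_ge1Dx (- X (zn n) s); lra.
    + exact: cvg_cst.
    + exact: powcvg.
  - exact: integ_norm.
  - move=> n s _; rewrite normrM ler_piMl//.
    have phi0 : 0 <= phi (zn n) s by rewrite /phi subr_ge0 expR_le1 oppr_le0 expR_ge0.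
    by rewrite (ger0_norm phi0) /phi; have := expR_ge0 (- X (zn n) s); lra.
have d0 : 0 < 1 - c - T by rewrite subr_gt0.
have cd : (fun n => del (zn n)) @ \oo --> (0 : R).
  apply: (@squeeze_cvgr _ _ _ _ (fun=> 0) (fun n => expR (- (1 - c - T)) ^+ n)).
  - apply: nearW => n; rewrite expR_ge0/=; apply: le_trans (zn_le n (ltW d0)).
    rewrite /del (_ : zn n * (T - 1 + c) = - (zn n * (1 - c - T)))//; ring.
  - exact: cvg_cst.
  - exact: powcvg.
have cb : (fun n => C * (expR (del (zn n)) - 1)) @ \oo --> (0 : R).
  rewrite -[X in _ --> X](mulr0 C); apply: cvgM; first exact: cvg_cst.
  rewrite -[X in _ --> X](subrr (1 : R)); apply: cvgB; last exact: cvg_cst.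
  rewrite -[X in _ --> X](@expR0 R).
  by apply: cvg_comp; [exact: cd|exact: continuous_expR].
apply/eqP; rewrite -normr_le0.
apply: (ler_cvg_to (cvg_norm cv) cb); apply: nearW => n; apply: phi_int.
by rewrite lerDl.
Qed.

End Mikusinski.

(** At almost every t the value of u is the derivative of its primitive; discarding both endpoints
    leaves a neighbourhood of t inside [0,1), where the primitive vanishes. *)
Lemma V_eq0_ae u : integ I u -> (forall T : R, 0 <= T < 1 -> V u T = 0) ->
  {ae mu, forall t, I t -> u t = 0}.
Proof.
move=> iu VT.
have iu0 : integ setT (u \_ I).
  by rewrite -restrict_EFin; apply/(@integrable_mkcond _ _ R mu _ (EFin \o u) mI).
have iy (y : R) : mu.-integrable [set` Interval (BLeft 0) (BRight y)] (EFin \o (u \_ I)).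
  exact: integrableS iu0.
have H := FTC1 iy (integrable_locally mI iu).
apply: (@filterS3 _ _ (ae_filter_ringOfSetsType mu) _ _ _ _ _ H (ae_neq 0) (ae_neq 1)).
move=> t Ft tn0 tn1 /[dup] It /I01_itv/andP[t0 t1].
have t0' : 0 < t by rewrite lt_neqAle t0 andbT eq_sym; apply/eqP.
have t1' : t < 1 by rewrite lt_neqAle t1 andbT; apply/eqP.
have [|_] := Ft; first by rewrite /= lte_fin.
rewrite derive1E patchE mem_set// => <-.
rewrite (@near_eq_derive _ _ _ _ (cst 0)) ?derive_cst//.
near=> s; rewrite -[RHS](VT s); last first.
  by apply/andP; split; [apply: ltW|]; near: s; [exact: lt_nbhsr|exact: lt_nbhsl].
apply: eq_Rintegral => r; rewrite mem_itvcc => /andP[r0 rs].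
rewrite patchE mem_set//; apply/I01_itv; rewrite r0 (le_trans rs)//.
by apply: ltW; near: s; exact: lt_nbhsl.
Unshelve. all: by end_near. Qed.

Lemma kx_gt0 x : L2 x -> L2norm x <> 0 -> (0 < kx (@volterra R) x)%E.
Proof.
move=> hx x0; rewrite ltNge; apply/negP => k0; apply: x0.
have [h1 h2] := hx.
have z u : sq_integrable u -> (forall c, 0 < c -> exists2 z0 : R, 0 <= z0 & forall z, z0 <= z ->
    `|expR z * expV z u 1| <= 2 * expR (c * z)) -> {ae mu, forall t, I t -> u t = 0}.
  move=> hu H; apply: V_eq0_ae; first exact: sqint_integ.
  (* With this c, T lies strictly below 1 - c = (1 + T) / 2. *)
  move=> T /andP[T0 T1]; have c0 : 0 < (1 - T) / 2 by lra.
  have [z0 z00 Hz] := H _ c0.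
  apply: (@mikusinski u ((1 - T) / 2) 2 z0) => //; [exact: sqint_integ|exact: ltW|lra|].
  move=> z zz; apply: le_trans (Hz z zz); rewrite /expV -RintegralZl//; last first.
    exact: integ_expM (sqint_integ hu).
  rewrite le_eqVlt; apply/orP; left; apply/eqP; congr `|_|; apply: eq_Rintegral => s _.
  by rewrite mulrA -expRD; congr (expR _ * _); ring.
have z1 : {ae mu, forall t, I t -> x.1 t = 0}.
  by apply: z => // c c0; have [z0 z00 H] := kx_small_growth hx c0 k0;
    exists z0 => // z zz; have [] := H z zz.
have z2 : {ae mu, forall t, I t -> x.2 t = 0}.
  by apply: z => // c c0; have [z0 z00 H] := kx_small_growth hx c0 k0;
    exists z0 => // z zz; have [] := H z zz.
pose o : cfun R := (fun=> 0, fun=> 0).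
have ho : L2 o by apply: L2_cont => t; exact: cst_continuous.
rewrite (@L2norm_ae R x o)//.
  rewrite /L2norm /=; under eq_Rintegral do rewrite expr0n/= addr0.
  by rewrite Rintegral_I01_cst sqrtr0.
apply: (@filterS2 _ _ (ae_filter_ringOfSetsType mu) _ _ _ _ z1 z2) => t e1 e2 It.
by rewrite e1// e2.
Qed.

End Positivity.

Theorem theoremC (R : realType) :
  power_set (@volterra R) = [set (r%:E)%E | r in `]0, 1]%classic].
Proof.
apply/seteqP; split => [_ [x [hx x0] <-]|_ [r r01 <-]].
  have k0 := kx_gt0 hx x0; have k1 := kx_le1 hx x0.
  have kf : kx (@volterra R) x \is a fin_num.
    by rewrite fin_numE gt_eqF ?lt_eqF// ?(le_lt_trans k1) ?ltry// (lt_trans _ k0) ?ltNyr.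
  exists (fine (kx (@volterra R) x)); last by rewrite fineK.
  by rewrite /= in_itv/= fine_gt0 ?k0 ?(le_lt_trans k1) ?ltry//= -lee_fin fineK.
move: r01; rewrite /= in_itv/= => r01; have /andP[r0 r1] := r01.
(* This ramp is supported on [1 - r, 1], and the exponential rate of its resolvent is the length r
   of the support. *)
exists (ramp_fun (1 - r)); last exact: kx_ramp.
split; first exact: ramp_fun_L2.
by apply: L2norm_ramp_neq0; rewrite subr_ge0 r1 ltrBlDr ltrDl.
Qed.
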